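(* Let $(V,h)$ be a quadratic space of dimension $m$, with associated spin space $(S,V,h)$, Lipschitz group $\mathrm{Lpin}(h)$, and homomorphism $\kappa$ given by $\kappa(a)w=awa^{-1}$ for $a\in \mathrm{Lpin}(h)$, $w\in A(h)$. (i) If $m$ is even, then there is a split exact sequence $$1\to \mathbb{C}^{\times}\cdot\mathrm{Spin}(h)\to \mathrm{Lpin}(h)\xrightarrow{\ \kappa\ }\mathbb{Z}_2\to 1,$$ and the group $\mathrm{Lpin}(h)$ is isomorphic to $\mathbb{C}^{\times}\cdot \mathrm{Pin}(h)$. (ii) If $m$ is odd, then there is the exact sequence $$1\to \mathbb{C}^{\times}\cdot\mathrm{Pin}(h)\to \mathrm{Lpin}(h)\xrightarrow{\ \kappa\ }\mathbb{Z}_2\times_{\varphi}\mathbb{C}^{\times}\to 1,$$ where the homomorphism $\varphi:\mathbb{Z}_2\to\mathrm{Aut}\,\mathbb{C}^{\times}$, defining the semi-direct product group structure, is given by $\varphi(-1)z=z^{-1}$, $z\in\mathbb{C}^{\times}$. There is an isomorphism of groups $$\bigl(\mathrm{Pin}(h)\times_{\psi}(\mathbb{C}^{\times}\times\mathbb{C}^{\times})\bigr)/\mathbb{Z}_2\to \mathrm{Lpin}(h)$$ such that if $a\in\mathrm{Pin}(h)\setminus\mathrm{Spin}(h)$, then $\psi(a)(\lambda,\mu)=(\mu,\lambda)$.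
   Context: A quadratic space $(V,h)$ is a finite-dimensional real vector space $V$ with a non-degenerate quadratic form $h:V\to\mathbb{R}$ (of any signature). $\mathrm{Cl}(h)$ is its real Clifford algebra, with $v^2=h(v)$ for $v\in V$; $\mathrm{Cl}^0(h)$ is its even subalgebra and $\alpha$ its grading automorphism extending $v\mapsto -v$. If $(e_1,\dots,e_m)$ is an orthonormal frame, $\eta=e_1\cdots e_m$ is a volume element, $\eta^2=\pm1$, and $\iota(h)\in\{1,\sqrt{-1}\}$ is defined by $\iota(h)^2=\eta^2$. If $m=2n$ is even, the Dirac representation is the faithful irreducible complex representation of $\mathrm{Cl}(h)$, of dimension $2^n$. If $m=2n-1$ is odd, the Pauli representation is the faithful irreducible complex representation of $\mathrm{Cl}^0(h)$ in a space $S_0$ of dimension $2^{n-1}$; it extends to two inequivalent representations $\sigma$ and $\sigma\circ\alpha$ of $\mathrm{Cl}(h)$, where $\sigma(\eta)=\iota(h)\,\mathrm{id}_{S_0}$; the Cartan representation of $\mathrm{Cl}(h)$ is $\sigma\oplus\sigma\circ\alpha$ in $S=S_0\oplus S_0$; it is faithful. The spin space $(S,V,h)$ constructed from $(V,h)$: $S$ is the complex space of the Dirac ($m$ even) or Cartan ($m$ odd) representation, and $V$ and $\mathrm{Cl}(h)$ are identified with their images in $\mathrm{End}\,S$ (complex-linear endomorphisms). $\mathrm{Pin}(h)\subset\mathrm{GL}(S)$ is the group generated by all $v\in V$ with $v^2=\mathrm{id}_S$ or $v^2=-\mathrm{id}_S$; $\mathrm{Spin}(h)=\mathrm{Pin}(h)\cap\mathrm{Cl}^0(h)$.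 $\mathrm{Lpin}(h)=\{a\in\mathrm{GL}(S): aVa^{-1}=V\}$. For $G=\mathrm{Pin}(h)$ or $\mathrm{Spin}(h)$, which contain $\mathbb{Z}_2=\{\pm1\}$, $\mathbb{C}^{\times}\cdot G$ denotes $(\mathbb{C}^{\times}\times G)/\mathbb{Z}_2$, with $\mathbb{Z}_2$ generated by $(-1,-1)$. Here $\psi:\mathrm{Pin}(h)\to\mathrm{Aut}(\mathbb{C}^{\times}\times\mathbb{C}^{\times})$ is the homomorphism defining the semi-direct product $\mathrm{Pin}(h)\times_{\psi}(\mathbb{C}^{\times}\times\mathbb{C}^{\times})$, whose quotient by $\mathbb{Z}_2$ identifies $(a,\lambda,\mu)$ with $(-a,-\lambda,-\mu)$. $A(h)=\{w\in\mathrm{End}\,S: wv+vw=0\text{ for every }v\in V\}$ is a complex vector space; there is a complex quadratic form $h_0$ on $A(h)$ with $w^2=h_0(w)\,\mathrm{id}_S$. The homomorphism $\kappa$ takes values in the complex orthogonal group $\mathrm{O}(h_0,\mathbb{C})$, which is $\mathrm{O}_1(\mathbb{C})=\mathbb{Z}_2$ for $m$ even, and is isomorphic to $\mathrm{O}_2(\mathbb{C})$ and identified with $\mathbb{Z}_2\times_\varphi\mathbb{C}^{\times}$ for $m$ odd.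
   Formalization: m > 0 is assumed (for m = 0, κ is not onto). For m odd the printed sequence is false, since κ(v) = −id for unit v: here the kernel of κ is C^×·Spin(h), and the sequence with C^×·Pin(h) is exact with κ followed by (ε,z) ↦ (ε,z²). *)

(* Defs.v *)
From HB Require Import structures.
From mathcomp Require Import all_boot all_order all_algebra.
From mathcomp Require Import generic_quotient boolp classical_sets reals.
From mathcomp Require Import complex.

Set Implicit Arguments.
Unset Strict Implicit.
Unset Printing Implicit Defensive.

Import Order.TTheory GRing.Theory Num.Theory.

Local Open Scope classical_set_scope.
Local Open Scope ring_scope.

(* Unlike [{group gT}], the ambient group is not assumed to be finite. *)
Record subgroup (G : groupType) := Subgroup {
  sg_set : set G;
  sg1 : sg_set 1%g;
  sgM : forall x y, sg_set x -> sg_set y -> sg_set (x * y)%g;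
  sgV : forall x, sg_set x -> sg_set x^-1%g }.

Section SubgroupGroup.
Variables (G : groupType) (H : subgroup G).

Record sg_type := SgElt { sgval :> G; _ : sgval \in sg_set H }.

HB.instance Definition _ := [isSub for sgval].
HB.instance Definition _ := [Choice of sg_type by <:].

Lemma sgP (x : sg_type) : sg_set H x.
Proof. exact: set_mem (valP x). Qed.

Definition sg_in (x : G) (Hx : sg_set H x) : sg_type := SgElt (mem_set Hx).

Definition sg_one := sg_in (sg1 H).
Definition sg_mul (x y : sg_type) := sg_in (sgM (sgP x) (sgP y)).
Definition sg_inv (x : sg_type) := sg_in (sgV (sgP x)).

Fact sg_mulA : associative sg_mul.
Proof. by move=> x y z; apply/val_inj; exact: mulgA. Qed.
Fact sg_mul1 : left_id sg_one sg_mul.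
Proof. by move=> x; apply/val_inj; exact: mul1g. Qed.
Fact sg_mulr1 : right_id sg_one sg_mul.
Proof. by move=> x; apply/val_inj; exact: mulg1. Qed.
Fact sg_mulV : left_inverse sg_one sg_inv sg_mul.
Proof. by move=> x; apply/val_inj; exact: mulVg. Qed.
Fact sg_mulrV : right_inverse sg_one sg_inv sg_mul.
Proof. by move=> x; apply/val_inj; exact: mulgV. Qed.

HB.instance Definition _ :=
  isGroup.Build sg_type sg_mulA sg_mul1 sg_mulr1 sg_mulV sg_mulrV.

End SubgroupGroup.

Coercion sg_type : subgroup >-> Sortclass.

Definition normal_sg (G : groupType) (H : subgroup G) : Prop :=
  forall x y, sg_set H x -> sg_set H (x ^ y)%g.

Section Generated.
Variables (G : groupType) (P : subgroup G -> Prop).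

Definition meet_set : set G := [set x | forall H, P H -> sg_set H x].

Fact meet_set1 : meet_set 1%g.
Proof. by move=> H _; exact: sg1. Qed.
Fact meet_setM x y : meet_set x -> meet_set y -> meet_set (x * y)%g.
Proof. by move=> Hx Hy H PH; apply: sgM; [exact: Hx | exact: Hy]. Qed.
Fact meet_setV x : meet_set x -> meet_set x^-1%g.
Proof. by move=> Hx H PH; apply: sgV; exact: Hx. Qed.

Definition meet_sg : subgroup G := Subgroup meet_set1 meet_setM meet_setV.

End Generated.

Definition generated (G : groupType) (A : set G) : subgroup G :=
  meet_sg (fun H => A `<=` sg_set H).

Definition normal_closure (G : groupType) (A : set G) : subgroup G :=
  meet_sg (fun H => normal_sg H /\ A `<=` sg_set H).

Section QuotientGroup.
Variables (G : groupType) (A : set G).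
Local Notation N := (normal_closure A).

Definition quo_rel (x y : G) : bool := `[< sg_set N (x^-1 * y)%g >].

Fact quo_rel_refl : reflexive quo_rel.
Proof. by move=> x; apply/asboolP; rewrite mulVg; exact: sg1. Qed.

Let quo_rel_symW x y : quo_rel x y -> quo_rel y x.
Proof.
by move=> /asboolP /sgV xy; apply/asboolP; rewrite invgM invgK in xy.
Qed.

Fact quo_rel_sym : symmetric quo_rel.
Proof. by move=> x y; apply/idP/idP; exact: quo_rel_symW. Qed.

Fact quo_rel_trans : transitive quo_rel.
Proof.
move=> y x z /asboolP xy /asboolP yz; apply/asboolP.
by have := sgM xy yz; rewrite mulgA mulgK.
Qed.

Canonical quo_equiv :=
  EquivRel quo_rel quo_rel_refl quo_rel_sym quo_rel_trans.

(* The quotient of G by the smallest normal subgroup containing A; when A = {z}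
   with z central of order two, this is the quotient by Z_2 = {1, z}. *)
Definition quo : Type := {eq_quot quo_equiv}%qT.
HB.instance Definition _ := Choice.on quo.
HB.instance Definition _ := Quotient.on quo.
HB.instance Definition _ := EqQuotient.on quo.

Definition toquo (x : G) : quo := \pi_(quo)%qT x.

Let normalN : normal_sg N.
Proof. by move=> x y Hx H [nH AH]; exact: (nH _ _ (Hx H (conj nH AH))). Qed.

Lemma toquo_eqP x y : reflect (sg_set N (x^-1 * y)%g) (toquo x == toquo y).
Proof. by rewrite /toquo eqmodE; exact: asboolP. Qed.

Lemma reprqK (X : quo) : toquo (repr X) = X.
Proof. exact: reprK. Qed.

Definition quo_mul (X Y : quo) : quo := toquo (repr X * repr Y)%g.
Definition quo_inv (X : quo) : quo := toquo (repr X)^-1%g.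

Lemma toquo_repr x : sg_set N ((repr (toquo x))^-1 * x)%g.
Proof. by apply/toquo_eqP; rewrite reprqK. Qed.

Lemma toquoM x y : quo_mul (toquo x) (toquo y) = toquo (x * y)%g.
Proof.
apply/eqP/toquo_eqP.
have nx := normalN y (toquo_repr x).
have := sgM (toquo_repr y) nx.
by rewrite conjgE invgM !mulgA mulgK.
Qed.

Lemma toquoV x : quo_inv (toquo x) = toquo x^-1%g.
Proof.
apply/eqP/toquo_eqP; rewrite invgK.
have := normalN x^-1%g (sgV (toquo_repr x)).
by rewrite conjgE invgK invgM invgK !mulgA mulgV mul1g.
Qed.

Fact quo_mulA : associative quo_mul.
Proof.
by move=> X Y Z; rewrite -[X]reprqK -[Y]reprqK -[Z]reprqK !toquoM mulgA.
Qed.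
Fact quo_mul1 : left_id (toquo 1%g) quo_mul.
Proof. by move=> X; rewrite -[X]reprqK toquoM mul1g. Qed.
Fact quo_mulr1 : right_id (toquo 1%g) quo_mul.
Proof. by move=> X; rewrite -[X]reprqK toquoM mulg1. Qed.
Fact quo_mulV : left_inverse (toquo 1%g) quo_inv quo_mul.
Proof. by move=> X; rewrite -[X]reprqK toquoV toquoM mulVg. Qed.
Fact quo_mulrV : right_inverse (toquo 1%g) quo_inv quo_mul.
Proof. by move=> X; rewrite -[X]reprqK toquoV toquoM mulgV. Qed.

HB.instance Definition _ :=
  isGroup.Build quo quo_mulA quo_mul1 quo_mulr1 quo_mulV quo_mulrV.

End QuotientGroup.

(* A homomorphism H -> Aut N, in uncurried form. *)
Record autaction (H N : groupType) := AutAction {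
  aa_fun :> H -> N -> N;
  aa1 : forall x, aa_fun 1%g x = x;
  aaM : forall a b x, aa_fun (a * b)%g x = aa_fun a (aa_fun b x);
  aa_mul : forall a x y, aa_fun a (x * y)%g = (aa_fun a x * aa_fun a y)%g }.

Definition sdprod (H N : groupType) (f : autaction H N) : Type := (H * N)%type.

Section SemidirectProduct.
Variables (H N : groupType) (f : autaction H N).

HB.instance Definition _ := Choice.copy (sdprod f) (H * N)%type.

Definition sd_one : sdprod f := (1%g, 1%g).
Definition sd_mul (x y : sdprod f) : sdprod f :=
  ((x.1 * y.1)%g, (x.2 * f x.1 y.2)%g).
Definition sd_inv (x : sdprod f) : sdprod f := (x.1^-1%g, f x.1^-1%g x.2^-1%g).

Let aa_one a : f a 1%g = 1%g.
Proof. by apply: (mulgI (f a 1%g)); rewrite -aa_mul !mulg1. Qed.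

Fact sd_mulA : associative sd_mul.
Proof.
by move=> [a x] [b y] [c z]; congr pair; rewrite /= ?aaM ?aa_mul mulgA.
Qed.
Fact sd_mul1 : left_id sd_one sd_mul.
Proof. by move=> [a x]; congr pair; rewrite /= ?aa1 mul1g. Qed.
Fact sd_mulr1 : right_id sd_one sd_mul.
Proof. by move=> [a x]; congr pair; rewrite /= ?aa_one mulg1. Qed.
Fact sd_mulV : left_inverse sd_one sd_inv sd_mul.
Proof. by move=> [a x]; congr pair; rewrite /= -?aa_mul mulVg ?aa_one. Qed.
Fact sd_mulrV : right_inverse sd_one sd_inv sd_mul.
Proof. by move=> [a x]; congr pair; rewrite /= -?aaM mulgV // aa1 mulgV. Qed.

HB.instance Definition _ :=
  isGroup.Build (sdprod f) sd_mulA sd_mul1 sd_mulr1 sd_mulV sd_mulrV.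

End SemidirectProduct.

Definition isomorphic (G H : groupType) : Prop :=
  exists f : {multiplicative G -> H}, bijective f.

Definition exact_seq (A B C : groupType) (i : {multiplicative A -> B})
    (p : {multiplicative B -> C}) : Prop :=
  [/\ injective i,
      forall b, p b = 1%g <-> exists a, i a = b &
      forall c, exists b, p b = c].

Definition split_exact_seq (A B C : groupType) (i : {multiplicative A -> B})
    (p : {multiplicative B -> C}) : Prop :=
  exact_seq i p /\ exists s : {multiplicative C -> B}, cancel s p.

Section MulGroup.
Variable F : fieldType.

Record mulgrp := MulGrp { mgval :> F; _ : mgval != 0 }.

HB.instance Definition _ := [isSub for mgval].
HB.instance Definition _ := [Choice of mulgrp by <:].

Lemma mgP (x : mulgrp) : mgval x != 0. Proof. exact: (valP x). Qed.

Definition mg_one : mulgrp := MulGrp (oner_neq0 F).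
Definition mg_mul (x y : mulgrp) : mulgrp := MulGrp (mulf_neq0 (mgP x) (mgP y)).
Definition mg_inv (x : mulgrp) : mulgrp := MulGrp (invr_neq0 (mgP x)).

Fact mg_mulA : associative mg_mul.
Proof. by move=> x y z; apply/val_inj; exact: mulrA. Qed.
Fact mg_mul1 : left_id mg_one mg_mul.
Proof. by move=> x; apply/val_inj; exact: mul1r. Qed.
Fact mg_mulr1 : right_id mg_one mg_mul.
Proof. by move=> x; apply/val_inj; exact: mulr1. Qed.
Fact mg_mulV : left_inverse mg_one mg_inv mg_mul.
Proof. by move=> x; apply/val_inj; rewrite /= mulVf ?mgP. Qed.
Fact mg_mulrV : right_inverse mg_one mg_inv mg_mul.
Proof. by move=> x; apply/val_inj; rewrite /= mulfV ?mgP. Qed.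

HB.instance Definition _ :=
  isGroup.Build mulgrp mg_mulA mg_mul1 mg_mulr1 mg_mulV mg_mulrV.

Lemma mgC (x y : mulgrp) : (x * y = y * x)%g.
Proof. by apply/val_inj; exact: mulrC. Qed.

Lemma mg_invM (x y : mulgrp) : ((x * y)^-1 = x^-1 * y^-1)%g.
Proof. by rewrite invgM mgC. Qed.

Fact mg_opp1_subproof : -1 != 0 :> F.
Proof. by rewrite oppr_eq0 oner_eq0. Qed.
Definition mg_opp1 : mulgrp := MulGrp mg_opp1_subproof.

Lemma mg_opp1M : (mg_opp1 * mg_opp1 = 1)%g.
Proof. by apply: val_inj; rewrite /= mulrNN mulr1. Qed.

Definition Z2_set : set mulgrp := [set x | x = 1%g \/ x = mg_opp1].

Fact Z2_set1 : Z2_set 1%g. Proof. by left. Qed.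
Fact Z2_setM x y : Z2_set x -> Z2_set y -> Z2_set (x * y)%g.
Proof.
by move=> [->|->] [->|->]; rewrite ?mulg1 ?mul1g ?mg_opp1M;
  solve [by left | by right].
Qed.
Fact Z2_setV x : Z2_set x -> Z2_set x^-1%g.
Proof.
move=> [->|->]; [by left; rewrite invg1 | right].
by apply: (mulgI mg_opp1); rewrite mulgV mg_opp1M.
Qed.

Definition Z2 : subgroup mulgrp := Subgroup Z2_set1 Z2_setM Z2_setV.

Definition inv_fun (e : Z2) (z : mulgrp) : mulgrp :=
  if e == 1%g then z else z^-1%g.

Fact inv_fun1 z : inv_fun 1%g z = z.
Proof. by rewrite /inv_fun eqxx. Qed.

Lemma Z2_nontriv (e : Z2) : e != 1%g -> val e = mg_opp1.
Proof.
move=> e1; case: (sgP e) => // E.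
by case/eqP: e1; apply: val_inj.
Qed.

Fact inv_funM (a b : Z2) z : inv_fun (a * b)%g z = inv_fun a (inv_fun b z).
Proof.
rewrite /inv_fun; have [->|a1] := eqVneq a 1%g; first by rewrite mul1g.
have [->|b1] := eqVneq b 1%g; first by rewrite mulg1 (negPf a1).
have -> : (a * b)%g = 1%g.
  apply: val_inj; rewrite [LHS]/= (Z2_nontriv a1) (Z2_nontriv b1).
  exact: mg_opp1M.
by rewrite eqxx invgK.
Qed.

Fact inv_fun_mul (a : Z2) x y :
  inv_fun a (x * y)%g = (inv_fun a x * inv_fun a y)%g.
Proof. by rewrite /inv_fun; case: ifP => // _; rewrite mg_invM. Qed.

Definition phi : autaction Z2 mulgrp := AutAction inv_fun1 inv_funM inv_fun_mul.

(* The endomorphism of Z_2 x_phi F^x squaring the second factor; its kernel is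
   {1} x {1, -1}.  Vectors of V act on Ah by -id, hence Pin(h) lies in the kernel
   of kappa only modulo {id, -id}; sd_square realizes that quotient in odd
   dimension, while the kernel of kappa itself is C^x . Spin(h). *)
Definition sd_square (x : sdprod phi) : sdprod phi := (x.1, (x.2 * x.2)%g).

Fact sd_squareM : {morph sd_square : x y / (x * y)%g}.
Proof.
move=> [a x] [b y]; congr pair => /=.
rewrite inv_fun_mul -!mulgA; congr (_ * _)%g.
by rewrite !mulgA; congr (_ * _)%g; exact: mgC.
Qed.

HB.instance Definition _ :=
  isMultiplicative.Build (sdprod phi) (sdprod phi) sd_square sd_squareM.

End MulGroup.

Section GeneralLinear.
Variables (F : fieldType) (S : vectType F).

Record GL := MkGL { glval :> 'End(S); _ : lker glval == 0%VS }.

HB.instance Definition _ := [isSub for glval].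
HB.instance Definition _ := [Choice of GL by <:].

Lemma glP (x : GL) : lker x == 0%VS. Proof. exact: (valP x). Qed.

Fact gl_one_subproof : lker (\1%VF : 'End(S)) == 0%VS.
Proof. by apply/lker0P => u v; rewrite !lfunE. Qed.
Definition gl_one : GL := MkGL gl_one_subproof.

Fact gl_mul_subproof (x y : GL) : lker (x \o y)%VF == 0%VS.
Proof.
by apply/lker0P => u v; rewrite !lfunE /= => /(lker0P (glP x)) /(lker0P (glP y)).
Qed.
Definition gl_mul x y : GL := MkGL (gl_mul_subproof x y).

Fact gl_inv_subproof (x : GL) : lker (x^-1)%VF == 0%VS.
Proof. exact/lker0P/can_inj/lker0_lfunVK/glP. Qed.
Definition gl_inv x : GL := MkGL (gl_inv_subproof x).

Fact gl_mulA : associative gl_mul.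
Proof. by move=> x y z; apply/val_inj; exact: comp_lfunA. Qed.
Fact gl_mul1 : left_id gl_one gl_mul.
Proof. by move=> x; apply/val_inj; exact: comp_lfun1l. Qed.
Fact gl_mulr1 : right_id gl_one gl_mul.
Proof. by move=> x; apply/val_inj; exact: comp_lfun1r. Qed.
Fact gl_mulV : left_inverse gl_one gl_inv gl_mul.
Proof. by move=> x; apply/val_inj; rewrite /= lker0_compVf ?glP. Qed.
Fact gl_mulrV : right_inverse gl_one gl_inv gl_mul.
Proof. by move=> x; apply/val_inj; rewrite /= lker0_compfV ?glP. Qed.

HB.instance Definition _ :=
  isGroup.Build GL gl_mulA gl_mul1 gl_mulr1 gl_mulV gl_mulrV.

Definition gl_conj (a : GL) (w : 'End(S)) : 'End(S) := (a \o w \o a^-1)%VF.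

Lemma gl_conj1 w : gl_conj 1%g w = w.
Proof.
rewrite /gl_conj -[RHS]comp_lfun1r -(lker0_compfV (glP 1%g)) comp_lfunA.
by congr (_ \o _)%VF; rewrite comp_lfun1l comp_lfun1r.
Qed.

Lemma gl_conjM a b w : gl_conj (a * b)%g w = gl_conj a (gl_conj b w).
Proof.
have abV : ((glval (a * b)%g)^-1 = b^-1 \o a^-1)%VF.
  by have /(congr1 glval) := invgM a b.
by rewrite /gl_conj abV !comp_lfunA.
Qed.

Lemma gl_conjK a : cancel (gl_conj a) (gl_conj a^-1%g).
Proof. by move=> w; rewrite -gl_conjM mulVg gl_conj1. Qed.

Lemma gl_conjVK a : cancel (gl_conj a^-1%g) (gl_conj a).
Proof. by move=> w; rewrite -gl_conjM mulgV gl_conj1. Qed.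

Fact gl_conj_is_linear a : linear (gl_conj a).
Proof.
move=> k u v; rewrite /gl_conj comp_lfunDr comp_lfunDl.
by rewrite -comp_lfunZr -comp_lfunZl.
Qed.
HB.instance Definition _ a :=
  GRing.isLinear.Build F 'End(S) 'End(S) _ (gl_conj a) (gl_conj_is_linear a).

Lemma gl_conj_comp a u v :
  gl_conj a (u \o v)%VF = (gl_conj a u \o gl_conj a v)%VF.
Proof.
rewrite /gl_conj -!comp_lfunA; congr (_ \o (_ \o _))%VF.
by rewrite lker0_compKf // glP.
Qed.

Lemma gl_conj_id a : gl_conj a \1%VF = \1%VF.
Proof. by rewrite /gl_conj comp_lfun1r lker0_compfV // glP. Qed.

End GeneralLinear.

Section QuadraticSpace.
Variables (R : realType) (V : vectType R) (h : V -> R).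

Definition polar (v w : V) : R := h (v + w) - h v - h w.

Definition quadratic_form : Prop :=
  (forall a v, h (a *: v) = a ^+ 2 * h v) /\
  (forall a u v w, polar (a *: u + v) w = a * polar u w + polar v w).

Definition nondegenerate_form : Prop :=
  forall v, (forall w, polar v w = 0) -> v = 0.

Definition orthonormal_frame (e : (\dim {:V}).-tuple V) : Prop :=
  (forall i, h (tnth e i) = 1 \/ h (tnth e i) = -1) /\
  (forall i j, i != j -> polar (tnth e i) (tnth e j) = 0).

(* A Clifford algebra of h, i.e. a solution of the universal problem that
   characterizes Cl(h) up to unique isomorphism. *)
Record clifford_algebra := CliffordAlgebra {
  cl_alg :> algType R;
  cl_in : {linear V -> cl_alg};
  cl_sq : forall v, cl_in v * cl_in v = (h v)%:A;
  cl_univ : forall (B : algType R) (f : {linear V -> B}),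
    (forall v, f v * f v = (h v)%:A) ->
    exists g : {lrmorphism cl_alg -> B},
      (forall v, g (cl_in v) = f v) /\
      (forall g' : {lrmorphism cl_alg -> B},
         (forall v, g' (cl_in v) = f v) -> g' =1 g) }.

Variable Cl : clifford_algebra.

Fact grading_ex :
  exists g : {lrmorphism Cl -> Cl}, forall v, g (cl_in Cl v) = - cl_in Cl v.
Proof.
have [|g [gE _]] := @cl_univ Cl Cl (\- cl_in Cl : {linear V -> Cl}).
  by move=> v; rewrite /= mulrNN cl_sq.
by exists g.
Qed.

Definition grading : {lrmorphism Cl -> Cl} := projT1 (cid grading_ex).

Definition Cl_even : set Cl := [set x | grading x = x].

Definition volume (e : (\dim {:V}).-tuple V) : Cl :=
  \prod_(i < \dim {:V}) cl_in Cl (tnth e i).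

(* volume e squares to 1 or -1 when e is orthonormal; iota_h is the
   corresponding square root. *)
Definition iota_h (e : (\dim {:V}).-tuple V) : R[i] :=
  if volume e * volume e == 1 then 1 else 'i%C.

End QuadraticSpace.

Arguments Cl_even {R V h} Cl _.

Record rep (R : realType) (A : algType R) (S : vectType R[i]) := Rep {
  rep_fun :> A -> 'End(S);
  repD : forall x y, rep_fun (x + y) = rep_fun x + rep_fun y;
  repZ : forall (a : R) x, rep_fun (a *: x) = a%:C%C *: rep_fun x;
  rep1 : rep_fun 1 = \1%VF;
  repM : forall x y, rep_fun (x * y) = (rep_fun x \o rep_fun y)%VF }.

Section Representations.
Variables (R : realType) (A : algType R) (S : vectType R[i]) (g : rep A S).

Definition faithful_on (D : set A) : Prop := {in D &, injective g}.

Definition irreducible_on (D : set A) : Prop :=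
  (0 < \dim {:S})%N /\
  forall U : {vspace S}, (forall x, D x -> (g x @: U <= U)%VS) ->
    U = 0%VS \/ U = fullv.

End Representations.

Section SpinSpace.
Variables (R : realType) (V : vectType R) (h : V -> R) (Cl : clifford_algebra h).
Local Notation m := (\dim {:V}).

Definition dirac_rep (S : vectType R[i]) (g : rep Cl S) : Prop :=
  [/\ faithful_on g setT, irreducible_on g setT & \dim {:S} = (2 ^ m./2)%N].

(* s is an extension to Cl(h) of the Pauli representation of Cl^0(h). *)
Definition pauli_rep (S0 : vectType R[i]) (s : rep Cl S0) : Prop :=
  [/\ faithful_on s (Cl_even Cl),
      irreducible_on s (Cl_even Cl),
      \dim {:S0} = (2 ^ m./2)%N &
      exists2 e, orthonormal_frame h e &
        s (volume Cl e) = iota_h Cl e *: \1%VF].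

(* g is equivalent to s (+) (s o alpha), through j. *)
Definition cartan_rep (S : vectType R[i]) (g : rep Cl S) : Prop :=
  exists (S0 : vectType R[i]) (s : rep Cl S0), pauli_rep s /\
  exists2 j : {linear (S0 * S0)%type -> S}, bijective j &
    forall x u v, g x (j (u, v)) = j (s x u, s (grading Cl x) v).

Definition spin_rep (S : vectType R[i]) (g : rep Cl S) : Prop :=
  if odd m then cartan_rep g else dirac_rep g.

Variables (S : vectType R[i]) (g : rep Cl S).

Definition Vimg : set 'End(S) := range (fun v => g (cl_in Cl v)).

Definition Pin : subgroup (GL S) :=
  generated [set a : GL S | Vimg a /\
    ((a \o a)%VF = \1%VF :> 'End(S) \/ (a \o a)%VF = - \1%VF :> 'End(S))].

Definition in_Cl_even (a : 'End(S)) : Prop := exists2 x, Cl_even Cl x & a = g x.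

Let alpha : {lrmorphism Cl -> Cl} := grading Cl.

Let alphaM x y : alpha (x * y) = alpha x * alpha y.
Proof. exact: rmorphM. Qed.

Let homogeneous (a : 'End(S)) : Prop :=
  exists2 x, alpha x = x \/ alpha x = - x & a = g x.

Let homogeneousM a b :
  homogeneous a -> homogeneous b -> homogeneous (a \o b)%VF.
Proof.
move=> [x ax ->] [y ay ->]; exists (x * y); last by rewrite repM.
by rewrite alphaM; case: ax => ->; case: ay => ->;
  rewrite ?mulrNN ?mulrN ?mulNr; auto.
Qed.

Let homog_set : set (GL S) :=
  [set a : GL S | homogeneous a /\ homogeneous (a^-1)%g].

Let homog1 : homog_set 1%g.
Proof.
have h1 : homogeneous (1%g : GL S).
  by exists 1; [left; exact: rmorph1 | rewrite rep1].
by split; rewrite ?invg1.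
Qed.

Let homogM x y : homog_set x -> homog_set y -> homog_set (x * y)%g.
Proof.
move=> [hx hx'] [hy hy']; split; first exact: homogeneousM.
by rewrite invgM; exact: homogeneousM.
Qed.

Let homogV x : homog_set x -> homog_set x^-1%g.
Proof. by move=> [hx hx']; split => //; rewrite invgK. Qed.

Let repN x : g (- x) = - g x.
Proof. by rewrite -scaleN1r repZ rmorphN1 scaleN1r. Qed.

Let Pin_homog a : sg_set Pin a -> homog_set a.
Proof.
move=> /(_ (Subgroup homog1 homogM homogV)); apply => b [[v _ vb] bb] /=.
have av : alpha (cl_in Cl v) = - cl_in Cl v by exact: (projT2 (cid (grading_ex Cl))).
split; first by exists (cl_in Cl v) => //; right.
have := lker0_compKf (glP b) (b : 'End(S)).
case: bb => ->; rewrite ?comp_lfunNr comp_lfun1r => bV.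
  by exists (cl_in Cl v); [right | rewrite vb -bV].
exists (- cl_in Cl v); first by right; exact: etrans (raddfN alpha _) (congr1 -%R av).
by rewrite repN vb -bV opprK.
Qed.

Let spin_set : set (GL S) := [set a | sg_set Pin a /\ in_Cl_even a].

Fact spin_set1 : spin_set 1%g.
Proof.
split; first exact: sg1.
by exists 1; [exact: rmorph1 | rewrite rep1].
Qed.

Fact spin_setM x y : spin_set x -> spin_set y -> spin_set (x * y)%g.
Proof.
move=> [Px [a ax xa]] [Py [b bx yb]]; split; first exact: sgM.
exists (a * b); last by rewrite repM -xa -yb.
by rewrite /Cl_even /= -/alpha alphaM; congr (_ * _).
Qed.

Fact spin_setV x : spin_set x -> spin_set x^-1%g.
Proof.
move=> [Px [a ax xa]]; split; first exact: sgV.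
have [_ [y ay xy]] := Pin_homog Px.
exists (y * a * y).
  rewrite /Cl_even /= -/alpha !alphaM [alpha a]ax.
  by case: ay => ->; rewrite // mulrN !mulNr opprK.
by rewrite !repM -xa -xy lker0_compVf ?glP // comp_lfun1l.
Qed.

Definition Spin : subgroup (GL S) := Subgroup spin_set1 spin_setM spin_setV.

Definition lpin_set : set (GL S) := [set a | gl_conj a @` Vimg = Vimg].

Fact lpin_set1 : lpin_set 1%g.
Proof.
rewrite /lpin_set /=; apply/seteqP; split=> w.
  by case=> u Vu <-; rewrite gl_conj1.
by exists w; rewrite ?gl_conj1.
Qed.

Fact lpin_setM x y : lpin_set x -> lpin_set y -> lpin_set (x * y)%g.
Proof.
move=> Lx Ly; rewrite /lpin_set /mkset.
have -> : gl_conj (x * y)%g = gl_conj x \o gl_conj y.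
  by apply/funext => w; exact: gl_conjM.
by rewrite -image_comp Ly Lx.
Qed.

Fact lpin_setV x : lpin_set x -> lpin_set x^-1%g.
Proof.
move=> Lx; rewrite /lpin_set /mkset -[in LHS]Lx image_comp.
rewrite (_ : _ \o _ = id) ?image_id //.
by apply/funext => w; exact: gl_conjK.
Qed.

Definition Lpin : subgroup (GL S) := Subgroup lpin_set1 lpin_setM lpin_setV.

(* The set below is {(-1, -1)} as soon as G contains -1. *)
Definition Cdot (G : subgroup (GL S)) : groupType :=
  quo [set x : mulgrp R[i] * G |
    mgval x.1 = -1 /\ glval (sgval x.2) = - \1%VF].

Definition anticomm (v : V) (w : 'End(S)) : 'End(S) :=
  ((w \o g (cl_in Cl v)) + (g (cl_in Cl v) \o w))%VF.

Fact anticomm_is_linear v : linear (anticomm v).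
Proof.
move=> k u w; rewrite /anticomm comp_lfunDr comp_lfunDl.
by rewrite -comp_lfunZr -comp_lfunZl scalerDr addrACA.
Qed.
HB.instance Definition _ v :=
  GRing.isLinear.Build R[i] 'End(S) 'End(S) _ (anticomm v)
    (anticomm_is_linear v).

(* Anticommuting with a basis of V is enough, see memAhP. *)
Definition Ah : {vspace 'End(S)} :=
  (\bigcap_(i < \dim {:V}) lker (linfun (anticomm (vbasis {:V})`_i)))%VS.

Lemma memAhP w : reflect
  (forall v, ((w \o g (cl_in Cl v)) + (g (cl_in Cl v) \o w))%VF = 0) (w \in Ah).
Proof.
apply: (iffP idP) => [wA v|wA]; last first.
  rewrite memvE; apply/subv_bigcapP => i _.
  by rewrite -memvE memv_ker lfunE /=; apply/eqP/wA.
have wAi i : anticomm (vbasis {:V})`_i w = 0.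
  have [lti|gei] := ltnP i (\dim {:V}); last first.
    rewrite nth_default ?size_tuple // /anticomm linear0.
    by rewrite -(scale0r (0 : Cl)) repZ rmorph0 scale0r comp_lfun0l comp_lfun0r addr0.
  move: wA; rewrite memvE => /subv_bigcapP /(_ (Ordinal lti) isT).
  by rewrite -memvE memv_ker lfunE /= => /eqP.
have addA a b : anticomm (a + b) w = anticomm a w + anticomm b w.
  by rewrite /anticomm linearD repD comp_lfunDr comp_lfunDl addrACA.
have mulA k a : anticomm (k *: a) w = k%:C%C *: anticomm a w.
  by rewrite /anticomm linearZ repZ -comp_lfunZr -comp_lfunZl -scalerDr.
rewrite -/(anticomm v w) (coord_vbasis (memvf v)).
apply: (big_ind (fun a => anticomm a w = 0)).
- by rewrite -(scale0r (0 : V)) mulA rmorph0 scale0r.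
- by move=> a b wa wb; rewrite addA wa wb addr0.
- by move=> i _; rewrite mulA wAi scaler0.
Qed.

(* The scalar such that w^2 = h0(w) id_S; it exists for w in Ah when S is a spin
   space, so the default value 0 is never used there. *)
Definition h0 (w : 'End(S)) : R[i] :=
  xget 0 [set l | (w \o w)%VF = l *: \1%VF].

Let O_set : set (GL (subvs_of Ah)) :=
  [set f : GL (subvs_of Ah) | forall w, h0 (vsval (f w)) = h0 (vsval w)].

Fact O_set1 : O_set 1%g.
Proof. by move=> w; rewrite lfunE. Qed.
Fact O_setM x y : O_set x -> O_set y -> O_set (x * y)%g.
Proof. by move=> Ox Oy w; rewrite lfunE /= Ox Oy. Qed.
Fact O_setV x : O_set x -> O_set x^-1%g.
Proof. by move=> Ox w; rewrite -Ox lker0_lfunVK // glP. Qed.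

Definition Oh0 : subgroup (GL (subvs_of Ah)) := Subgroup O_set1 O_setM O_setV.

Lemma conj_memAh a w : sg_set Lpin a -> w \in Ah -> gl_conj a w \in Ah.
Proof.
move=> La /memAhP wA; apply/memAhP => v.
have /= : Vimg (g (cl_in Cl v)) by exists v.
rewrite -[Vimg]La => -[u [v' _ <-] <-].
by rewrite -!gl_conj_comp -linearD /= wA linear0.
Qed.

Let kappa_end (a : GL S) : 'End(subvs_of Ah) :=
  linfun (vsproj Ah \o gl_conj a \o vsval).

Let kappa_endE a w : sg_set Lpin a ->
  vsval (kappa_end a w) = gl_conj a (vsval w).
Proof. by move=> La; rewrite lfunE /= vsprojK // conj_memAh // subvsP. Qed.

Fact kappa_subproof (a : Lpin) : lker (kappa_end (sgval a)) == 0%VS.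
Proof.
have La := sgP a.
apply/lker0P => u v /(congr1 vsval); rewrite !kappa_endE //.
by move=> /(can_inj (gl_conjK _)) /val_inj.
Qed.

Fact kappa_O (a : Lpin) : sg_set Oh0 (MkGL (kappa_subproof a)).
Proof.
have La := sgP a.
move=> w /=; rewrite kappa_endE // /h0; congr xget.
apply/seteqP; split=> l /= E.
  apply: (can_inj (gl_conjK (sgval a))).
  by rewrite gl_conj_comp E linearZ /= gl_conj_id.
by rewrite -gl_conj_comp E linearZ /= gl_conj_id.
Qed.

Definition kappa (a : Lpin) : Oh0 := sg_in (kappa_O a).

Lemma kappaE a (w : subvs_of Ah) :
  vsval (glval (sgval (kappa a)) w) = (sgval a \o vsval w \o (sgval a)^-1)%VF.
Proof. by have La := sgP a; rewrite /kappa /= kappa_endE. Qed.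

Fact kappaM : {morph kappa : x y / (x * y)%g}.
Proof.
move=> x y; apply/val_inj/val_inj/lfunP => w; apply: val_inj.
rewrite [LHS]kappaE [in RHS]/= comp_lfunE [RHS]kappaE.
by rewrite [vsval (kappa_end _ _)]kappaE; exact: gl_conjM.
Qed.
HB.instance Definition _ :=
  isMultiplicative.Build Lpin Oh0 kappa kappaM.

Definition Cdot_map (G H : subgroup (GL S)) (i : {multiplicative Cdot G -> H}) :
    Prop :=
  forall (l : mulgrp R[i]) (a : G),
    glval (sgval (i (toquo _ (l, a)))) = mgval l *: glval (sgval a).

Definition swap_action (psi : autaction Pin (mulgrp R[i] * mulgrp R[i])%type) :
    Prop :=
  forall a : Pin, ~ sg_set Spin (sgval a) ->
    forall l m, psi a (l, m) = (m, l).

Definition Pin_sdprod_quo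
    (psi : autaction Pin (mulgrp R[i] * mulgrp R[i])%type) : groupType :=
  quo [set x : sdprod psi | glval (sgval x.1) = - \1%VF /\
    mgval x.2.1 = -1 /\ mgval x.2.2 = -1].

End SpinSpace.

Arguments kappa {R V h Cl S} g a.

(* Main.v *)
Require Import Defs.
From HB Require Import structures.
From mathcomp Require Import all_boot all_order all_algebra.
From mathcomp Require Import boolp classical_sets reals.
From mathcomp Require Import complex ring.

Set Implicit Arguments.
Unset Strict Implicit.
Unset Printing Implicit Defensive.

Import Order.TTheory GRing.Theory Num.Theory.
Import VectorInternalTheory.

Local Open Scope ring_scope.

(** Let [T] be an invertible endomorphism of [S] of square -1 that anticommutes
    with all vectors: in even dimension a multiple of the volume element, in odd
    dimension the exchange of the two summands of the Cartan representation, up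
    to a factor.  Conjugation by a unit vector [u] induces on [V] the opposite of
    the reflection in [u], and conjugation by [T] induces -1, so that [u * T]
    induces the reflection itself.  Mapping even elements [p] of the Pin group to
    [p] and odd ones to [p * T] is multiplicative because [T * T = -1] (lemma
    [twistedM]); call [F] this homomorphism.  An element of the Lipschitz group
    acts on [V] by an isometry, and isometries are products of reflections
    ([cartan_dieudonne]).  Hence each element of the Lipschitz group is [d * F p]
    with [p] in the Pin group and [d] commuting with all vectors ([lpin_decomp]).

    What remains is the commutant of the vectors, given by Schur's lemma.  In even
    dimension it consists of the scalars.  In odd dimension it is spanned by the
    projections [E1] and [E2] onto the two summands of [S], and [E1 - E2] is
    a multiple of the volume element ([cartan_structure]).  Composition with [T]
    turns the commutant into A(h), which is therefore the line of [T] or a plane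
    on which [h0] is a hyperbolic form.  The isometries of the line are the two
    signs; those of the plane form the semi-direct product of the two signs and
    the nonzero complex numbers, because they preserve or exchange the isotropic
    lines ([odd_isometry_total]).  As [d], [p] and [T] act explicitly on A(h), the
    kernel and the image of [kappa] can be read off.  In odd dimension [T]
    exchanges [E1] and [E2], which gives the action of the Pin group on the
    commutant in the semi-direct product.

    The maps out of the quotients by (-1, -1) are injective because a scalar [c]
    in the Pin group is 1 or -1 ([Pin_scalar]).  The generators of the Pin group have
    square 1 or -1, so the determinant of [c] and hence [c] are roots of unity.
    Moreover [c] is real, because elements of the real Clifford algebra have real
    trace: a word in an orthonormal frame either is a shorter word up to sign, or
    has trace zero by anticommuting with something invertible, or is empty. *)

(** * Homomorphisms out of quotients and from graphs *)

Section Groups.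

Lemma generated_ind (G : groupType) (A : set G) (P : G -> Prop) :
  P 1%g -> (forall x y, P x -> P y -> P (x * y)%g) ->
  (forall x, P x -> P x^-1%g) -> (forall x, A x -> P x) ->
  forall x, sg_set (generated A) x -> P x.
Proof. by move=> P1 PM PV PA x /(_ (@Subgroup G P P1 PM PV)); exact. Qed.

Lemma sub_generated (G : groupType) (A : set G) x :
  A x -> sg_set (generated A) x.
Proof. by move=> Ax H; exact. Qed.

Definition hom_of (G H : groupType) (f : G -> H)
    (fM : {morph f : x y / (x * y)%g}) : {multiplicative G -> H} :=
  HB.pack f (isMultiplicative.Build G H f fM).

Lemma hom1 (G H : groupType) (f : {multiplicative G -> H}) : f 1%g = 1%g.
Proof. by apply: (mulgI (f 1%g)); rewrite -gmulfM !mulg1. Qed.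

Lemma homV (G H : groupType) (f : {multiplicative G -> H}) x :
  f x^-1%g = (f x)^-1%g.
Proof. by apply: (mulgI (f x)); rewrite -gmulfM !mulgV hom1. Qed.

(** The normal closure of [A] is the kernel of [f] as soon as this kernel has no
    elements besides those of [A] and the identity, so the elements of the
    closure need not be described. *)
Lemma quo_lift (G H : groupType) (A : set G) (f : {multiplicative G -> H}) :
  (forall x, A x -> f x = 1%g) -> (forall x, f x = 1%g -> x = 1%g \/ A x) ->
  exists F : {multiplicative quo A -> H},
    injective F /\ forall x, F (toquo A x) = f x.
Proof.
move=> fA fK.
have NE x : sg_set (normal_closure A) x <-> f x = 1%g.
  split; last first.
    by move=> /fK[->|Ax]; [exact: sg1 | move=> K [_]; exact].
  have h1 : f 1%g = 1%g by exact: hom1.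
  have hM u v : f u = 1%g -> f v = 1%g -> f (u * v)%g = 1%g.
    by move=> fu fv; rewrite gmulfM fu fv mulg1.
  have hV u : f u = 1%g -> f u^-1%g = 1%g by move=> fu; rewrite homV fu invg1.
  move=> /(_ (@Subgroup G [set u | f u = 1%g] h1 hM hV)); apply.
  split; last exact: fA.
  by move=> u v /= fu; rewrite conjgE !gmulfM fu mul1g -gmulfM mulVg hom1.
have Fq x : f (repr (toquo A x)) = f x.
  have /NE := @toquo_repr _ A x.
  rewrite gmulfM homV => /(canRL (mulVKg _)); rewrite mulg1 => -> //.
have FM : {morph (fun X : quo A => f (repr X)) : X Y / (X * Y)%g}.
  by move=> X Y; rewrite -gmulfM; exact: Fq.
exists (hom_of FM); split=> [X Y /= E|x /=]; last exact: Fq.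
rewrite -[X]reprqK -[Y]reprqK; apply/eqP/toquo_eqP/NE.
by rewrite gmulfM homV E mulVg.
Qed.

Lemma inj_surj_bij (T U : choiceType) (f : T -> U) :
  injective f -> (forall y, exists x, f x = y) -> bijective f.
Proof.
move=> fI fS; have fS' y : exists x, f x == y by have [x <-] := fS y; exists x.
exists (fun y => xchoose (fS' y)) => [x|y]; last exact/eqP/(xchooseP (fS' y)).
exact/fI/eqP/(xchooseP (fS' (f x))).
Qed.

Lemma isomorphic_sym (G H : groupType) : isomorphic G H -> isomorphic H G.
Proof.
case=> f [f' fK f'K].
have f'M : {morph f' : x y / (x * y)%g}.
  by move=> x y; apply: (can_inj fK); rewrite gmulfM !f'K.
by exists (hom_of f'M); exists f.
Qed.

(** The isomorphisms from the orthogonal group of [h0] are known through the way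
    an isometry acts on a few elements of A(h); giving them as graphs avoids
    a choice of coordinates on A(h). *)
Lemma graph_isom (G H : groupType) (r : G -> H -> Prop) :
  (forall x, exists y, r x y) -> (forall y, exists x, r x y) ->
  (forall x y y', r x y -> r x y' -> y = y') ->
  (forall x x' y, r x y -> r x' y -> x = x') ->
  (forall x x' y y', r x y -> r x' y' -> r (x * x')%g (y * y')%g) ->
  exists theta : {multiplicative G -> H},
    bijective theta /\ forall x, r x (theta x).
Proof.
move=> rT rS rF rI rM.
have [f rf] := choice rT.
have fM : {morph f : x y / (x * y)%g}.
  by move=> x y; apply: rF (rf _) _; exact: rM.
exists (hom_of fM); split => //; apply: inj_surj_bij => [x y /= E|y].
  by apply: rI (rf x) _; rewrite E.
by have [x rxy] := rS y; exists x; apply: rF (rf x) rxy.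
Qed.

End Groups.

(** * Schur's lemma *)

Section Schur.
Variables (R : realType) (S : vectType R[i]).
Implicit Types (w : 'End(S)).

Lemma lfun_eigenvector w : (0 < \dim {:S})%N ->
  exists c : R[i], exists2 u, u != 0 & w u = c *: u.
Proof.
rewrite dimvf => S0.
have [c rc] : exists c, root (char_poly (f2mx w)) c.
  by apply/closed_rootP; rewrite size_char_poly; case: (dim S) S0.
move: rc; rewrite -eigenvalue_root_char => /eigenvalueP[v vE v0].
exists c; exists (r2v v); last by rewrite unlock /= r2vK vE linearZ.
by apply: contraNneq v0 => /(congr1 v2r); rewrite r2vK linear0 => ->.
Qed.

(** Since [R[i]] is algebraically closed, [w] has an eigenvector; its eigenspace is
    stable under [D], hence is the whole space. *)
Lemma schur (A : algType R) (g : rep A S) (D : set A) w : irreducible_on g D ->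
  (forall x, D x -> (w \o g x)%VF = (g x \o w)%VF) -> exists c, w = c *: \1%VF.
Proof.
move=> [S0 irr] wg; have [c [u u0 wu]] := lfun_eigenvector w S0.
exists c; have [|K0|KT] := irr (lker (w - c *: \1%VF)).
- move=> x Dx; apply/subvP => _ /memv_imgP[v vK ->].
  move: vK; rewrite !memv_ker !lfun_simp !subr_eq0 => /eqP E.
  by rewrite -comp_lfunE wg // comp_lfunE E linearZ.
- have : u \in lker (w - c *: \1%VF) by rewrite memv_ker !lfun_simp wu subrr.
  by rewrite K0 memv0 (negPf u0).
- apply/lfunP => v; have : v \in lker (w - c *: \1%VF) by rewrite KT memvf.
  by rewrite memv_ker !lfun_simp subr_eq0 => /eqP.
Qed.

End Schur.

(** * Orthonormal frames *)

Section QuadraticForms.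
Variables (R : realType) (V : vectType R) (h : V -> R).
Hypothesis hq : quadratic_form h.
Local Notation pol := (polar h).

Lemma polarC u v : pol u v = pol v u.
Proof. by rewrite /polar (addrC u) addrAC. Qed.

Lemma polarDl u v w : pol (u + v) w = pol u w + pol v w.
Proof. by rewrite -[u]scale1r hq.2 mul1r scale1r. Qed.

Lemma polar0l w : pol 0 w = 0.
Proof. by apply: (addrI (pol 0 w)); rewrite -polarDl !addr0. Qed.

Lemma polarZl a v w : pol (a *: v) w = a * pol v w.
Proof. by rewrite -[a *: v]addr0 hq.2 polar0l addr0. Qed.

Lemma polarDr u v w : pol w (u + v) = pol w u + pol w v.
Proof. by rewrite !(polarC w) polarDl. Qed.

Lemma polarZr a v w : pol w (a *: v) = a * pol w v.
Proof. by rewrite !(polarC w) polarZl. Qed.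

Lemma polarNl v w : pol (- v) w = - pol v w.
Proof. by rewrite -scaleN1r polarZl mulN1r. Qed.

Lemma polarNr v w : pol w (- v) = - pol w v.
Proof. by rewrite !(polarC w) polarNl. Qed.

Lemma polar_diag v : pol v v = h v *+ 2.
Proof.
by rewrite /polar -[v + v]/(v *+ 2) -scaler_nat hq.1; ring.
Qed.

Lemma qformN v : h (- v) = h v.
Proof. by rewrite -scaleN1r hq.1 sqrrN expr1n mul1r. Qed.

Lemma polar_suml (I : Type) (r : seq I) (F : I -> V) w :
  pol (\sum_(i <- r) F i) w = \sum_(i <- r) pol (F i) w.
Proof.
by apply: (big_morph (pol^~ w)) => [u v|]; rewrite ?polarDl ?polar0l.
Qed.

Lemma polar_sumr (I : Type) (r : seq I) (F : I -> V) w :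
  pol w (\sum_(i <- r) F i) = \sum_(i <- r) pol w (F i).
Proof. by rewrite polarC polar_suml; apply: eq_bigr => i _; exact: polarC. Qed.

Lemma qformD u v : h (u + v) = h u + h v + pol u v.
Proof. by rewrite /polar; ring. Qed.

Definition orthonormal_seq (s : seq V) : Prop :=
  {in s, forall v, h v = 1 \/ h v = -1} /\
  pairwise (fun u v => pol u v == 0) s.

(** The polar form is twice the bilinear form of [h], whence the factor 2 in the
    coefficients of the projection. *)
Lemma orthonormal_seq_proj s x v : orthonormal_seq s -> v \in s ->
  pol (x - \sum_(u <- s) (pol x u / (h u *+ 2)) *: u) v = 0.
Proof.
move=> [s1 sO] vs.
have hv0 : h v *+ 2 != 0.
  by rewrite mulrn_eq0 /=; case: (s1 v vs) => ->; rewrite ?oppr_eq0 oner_eq0.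
rewrite polarDl polarNl polar_suml.
suff -> : \sum_(u <- s) pol ((pol x u / (h u *+ 2)) *: u) v = pol x v.
  by rewrite subrr.
(* Pairwise orthogonality is stated for the order of the sequence. *)
have sep u : u \in s -> u != v -> pol u v = 0.
  move: sO vs; elim: (s) => //= w s' IH /andP[/allP wO s'O].
  rewrite !inE => /predU1P[->|vs'] /predU1P[->|us'] //; first by rewrite eqxx.
  - by move=> _; rewrite polarC; apply/eqP/wO.
  - by move=> _; apply/eqP/wO.
  exact: IH.
have su : uniq s.
  move: sO s1 {sep vs}; elim: (s) => //= w s' IH /andP[/allP wO s'O] s1.
  rewrite IH ?andbT //; last by move=> u us'; apply: s1; rewrite inE us' orbT.
  apply/negP => /wO; rewrite polar_diag mulrn_eq0 /=.
  by case: (s1 w (mem_head _ _)) => ->; rewrite ?oppr_eq0 oner_eq0.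
rewrite (bigD1_seq v) //= big1_seq ?addr0; last first.
  by move=> u /andP[uv us]; rewrite polarZl sep ?mulr0.
by rewrite polarZl polar_diag divfK.
Qed.

Hypothesis hn : nondegenerate_form h.

(** If [h] vanished on the orthogonal complement [U] of [s], so would the polar
    form; since [s] and [U] span [V], nondegeneracy would give [U = 0], and [s]
    would already span [V]. *)
Lemma orthonormal_seq_extend s : orthonormal_seq s -> (size s < \dim {:V})%N ->
  exists v, orthonormal_seq (v :: s).
Proof.
move=> sO sV; pose U u := forall v, v \in s -> pol u v = 0.
have [u Uu hu] : exists2 u, U u & h u != 0.
  apply: contrapT => nU.
  have U0 u : U u -> h u = 0.
    by move=> Uu; apply: contrapT => /eqP hu; apply: nU; exists u.
  have UU u v : U u -> U v -> pol u v = 0.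
    move=> Uu Uv; rewrite /polar !U0 ?subrr // => w ws.
    by rewrite polarDl Uu // Uv // addr0.
  have Ux u : U u -> u = 0.
    move=> Uu; apply: hn => x.
    rewrite -[x](subrK (\sum_(v <- s) (pol x v / (h v *+ 2)) *: v)) polarDr.
    rewrite UU //; last by move=> v; exact: orthonormal_seq_proj.
    rewrite add0r polar_sumr big1_seq // => v /andP[_ vs].
    by rewrite polarZr Uu ?mulr0.
  suff /dimvS : (fullv <= <<s>>)%VS.
    by move=> /leq_trans/(_ (dim_span s)); rewrite leqNgt sV.
  apply/subvP => x _.
  have /Ux/eqP : U (x - \sum_(v <- s) (pol x v / (h v *+ 2)) *: v).
    by move=> v; exact: orthonormal_seq_proj.
  rewrite subr_eq0 => /eqP ->; rewrite big_seq memv_suml // => v vs.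
  by rewrite memvZ // memv_span.
(* Scaling by the square root of |h u| leaves the sign of h u. *)
pose v := (Num.sqrt `|h u|)^-1 *: u.
exists v; split; last first.
  rewrite /= sO.2 andbT; apply/allP => w ws; apply/eqP.
  by rewrite polarZl Uu ?mulr0.
move=> w; rewrite inE => /predU1P[->|]; last exact: sO.1.
rewrite hq.1 exprVn sqr_sqrtr //.
by have [?|?] := ger0P (h u); [left|right]; rewrite ?invrN ?mulNr mulVf.
Qed.

Lemma orthonormal_frame_ex : exists e, orthonormal_frame h e.
Proof.
have [s [sV sO]] : exists s, size s = \dim {:V} /\ orthonormal_seq s.
  suff: forall k, (k <= \dim {:V})%N -> exists s, size s = k /\ orthonormal_seq s.
    by apply.
  elim=> [_|k IH kV]; first by exists [::]; do 2!split.
  have [s [sk sO]] := IH (ltnW kV).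
  have [|v vO] := orthonormal_seq_extend sO; first by rewrite sk.
  by exists (v :: s); rewrite /= sk.
have sT : size s == \dim {:V} by apply/eqP.
exists (Tuple sT); split=> [i|i j].
  by apply: sO.1; exact: (mem_tnth i (Tuple sT)).
rewrite !(tnth_nth 0) /=.
have /(pairwiseP 0) sP := sO.2.
rewrite neq_ltn => /orP[ij|ij]; last rewrite polarC.
  by apply/eqP/sP => //; rewrite inE /= sV.
by apply/eqP/sP => //; rewrite inE /= sV.
Qed.

Section Frame.
Variables (e : (\dim {:V}).-tuple V).
Hypothesis eO : orthonormal_frame h e.

Lemma frame_basis : basis_of fullv e.
Proof.
rewrite basisEfree subvf size_tuple leqnn !andbT.
apply/freeP => k k0 i; have := polar0l (tnth e i).
rewrite -{}k0 polar_suml (bigD1 i) //= big1 ?addr0; last first.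
  by move=> j ji; rewrite polarZl -tnth_nth (eO.2 _ _ ji) mulr0.
rewrite polarZl -tnth_nth polar_diag => /eqP; rewrite mulf_eq0 mulrn_eq0 /=.
by case/orP=> [/eqP//|]; case: (eO.1 i) => ->; rewrite ?oppr_eq0 oner_eq0.
Qed.

Lemma frame_expand v : exists k : 'I_(\dim {:V}) -> R, v = \sum_i k i *: tnth e i.
Proof.
exists (fun i => coord e i v).
rewrite [LHS](coord_basis frame_basis (memvf v)).
by apply: eq_bigr => i _; rewrite -tnth_nth.
Qed.

End Frame.
End QuadraticForms.

(** * Vectors generate the Clifford algebra *)

Section CliffordGeneration.
Variables (R : realType) (V : vectType R) (h : V -> R) (Cl : clifford_algebra h).

Lemma clifford_anticomm v w : cl_in Cl v * cl_in Cl w + cl_in Cl w * cl_in Cl v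
  = (polar h v w)%:A.
Proof.
rewrite /polar !scalerBl -!cl_sq linearD mulrDl !mulrDr.
by apply/esym/eqP; rewrite !subr_eq [X in _ == X]addrC !addrA.
Qed.

Section Induction.
Variable P : Cl -> Prop.
Hypotheses (P1 : P 1) (PV : forall v, P (cl_in Cl v))
  (PM : forall x y, P x -> P y -> P (x * y))
  (PD : forall a x y, P x -> P y -> P (a *: x + y)).

Let S : pred Cl := fun x => `[< P x >].
Let S_closed : subalg_closed S.
Proof.
by split=> [|a x y|x y]; rewrite -!topredE /= /S ?asboolE //; [exact: PD|exact: PM].
Qed.
HB.instance Definition _ := GRing.isSubalgClosed.Build R Cl S S_closed.
Record subalg := SubAlg { alg_val :> Cl; _ : S alg_val }.
Local Notation B := subalg.
HB.instance Definition _ := [isSub for alg_val].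
HB.instance Definition _ := [Choice of B by <:].
HB.instance Definition _ := [SubChoice_isSubAlgebra of B by <:].

(** The elements satisfying [P] form a subalgebra containing the vectors.  The
    universal property maps the Clifford algebra into it, and its uniqueness
    clause makes the composite with the inclusion the identity. *)
Lemma clifford_ind x : P x.
Proof.
pose j0 v : B := @SubAlg (cl_in Cl v) (asboolT (PV v)).
have j_lin : linear j0 by move=> a u v; apply: val_inj; rewrite /= linearP.
pose j : {linear V -> B} := HB.pack j0 (GRing.isLinear.Build R V B _ j0 j_lin).
have [|p [pj _]] := @cl_univ _ _ _ Cl B j.
  by move=> v; apply: val_inj; rewrite /= cl_sq.
have [|q [_ qU]] := @cl_univ _ _ _ Cl Cl (cl_in Cl); first exact: cl_sq.
pose r0 x := alg_val (p x).
have r_lin : linear r0 by move=> a u v; rewrite /r0 linearP.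
have r_mor : monoid_morphism r0.
  by split=> [|u v]; rewrite /r0 ?rmorph1 ?rmorphM.
pose r : {lrmorphism Cl -> Cl} := HB.pack r0
  (GRing.isLinear.Build R Cl Cl _ r0 r_lin)
  (GRing.isMonoidMorphism.Build Cl Cl r0 r_mor).
have := qU r.
have := qU idfun.
move=> /(_ (fun=> erefl)) E1 /(_ (fun v => congr1 val (pj v))) E2.
have xE : x = r0 x by exact: etrans (E1 x) (esym (E2 x)).
by rewrite xE; apply/asboolP; exact: valP (p x : B).
Qed.
End Induction.
End CliffordGeneration.

(** * Trace and determinant of endomorphisms *)

Section Traces.
Variables (F : fieldType) (S : vectType F).
Implicit Types (f : 'End(S)).

Lemma v2r_lfun f u : v2r (f u) = v2r u *m f2mx f.
Proof. by rewrite unlock /= r2vK. Qed.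

Lemma f2mx_eq f (M : 'M_(dim S)) :
  (forall u, v2r (f u) = v2r u *m M) -> f2mx f = M.
Proof.
move=> fM; apply/row_matrixP => i.
by rewrite !rowE -[delta_mx 0 i]r2vK -v2r_lfun fM.
Qed.

Lemma f2mx_comp f1 f2 : f2mx (f1 \o f2)%VF = f2mx f2 *m f2mx f1.
Proof. by apply: f2mx_eq => u; rewrite comp_lfunE !v2r_lfun mulmxA. Qed.

Lemma f2mx_linear : linear (@f2mx F S S).
Proof.
move=> k f1 f2; apply: f2mx_eq => u.
by rewrite !lfun_simp linearP /= !v2r_lfun mulmxDr -scalemxAr.
Qed.

Lemma f2mx_scal c : f2mx (c *: \1%VF : 'End(S)) = c%:M.
Proof.
by apply: f2mx_eq => u; rewrite !lfun_simp linearZ /= mul_mx_scalar.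
Qed.

Definition lfun_det f := \det (f2mx f).
Definition lfun_tr f := \tr (f2mx f).

Lemma lfun_det_comp f1 f2 : lfun_det (f1 \o f2)%VF = lfun_det f1 * lfun_det f2.
Proof. by rewrite /lfun_det f2mx_comp det_mulmx mulrC. Qed.

Lemma lfun_det_scal c : lfun_det (c *: \1%VF) = c ^+ \dim {:S}.
Proof. by rewrite /lfun_det f2mx_scal det_scalar dimvf. Qed.

Lemma lfun_tr_comp f1 f2 : lfun_tr (f1 \o f2)%VF = lfun_tr (f2 \o f1)%VF.
Proof. by rewrite /lfun_tr !f2mx_comp mxtrace_mulC. Qed.

Lemma lfun_trP c f1 f2 : lfun_tr (c *: f1 + f2) = c * lfun_tr f1 + lfun_tr f2.
Proof. by rewrite /lfun_tr f2mx_linear mxtraceD mxtraceZ. Qed.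

Lemma lfun_tr_scal c : lfun_tr (c *: \1%VF) = c *+ \dim {:S}.
Proof. by rewrite /lfun_tr f2mx_scal mxtrace_scalar dimvf. Qed.

End Traces.

Lemma scaler_injr (F : fieldType) (W : lmodType F) (w : W) (k l : F) :
  w != 0 -> k *: w = l *: w -> k = l.
Proof.
move=> w0 /eqP; rewrite -subr_eq0 -scalerBl scaler_eq0 (negPf w0) orbF.
by rewrite subr_eq0 => /eqP.
Qed.

Lemma mg_valM (F : fieldType) (b c : mulgrp F) :
  mgval (b * c)%g = mgval b * mgval c.
Proof. by []. Qed.

(** * Scalars in the general linear group *)

Section LinearGroup.
Variables (F : fieldType) (S : vectType F).
Implicit Types (a b : GL S) (f : 'End(S)) (c d : mulgrp F).

Lemma gl_inj a b : glval a = glval b -> a = b.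
Proof. exact: val_inj. Qed.

Lemma mg_inj c d : mgval c = mgval d -> c = d.
Proof. exact: val_inj. Qed.

Lemma glM a b : glval (a * b)%g = (a \o b)%VF. Proof. by []. Qed.

Lemma gl_conjP a f1 f2 : gl_conj a f1 = f2 <-> (a \o f1 = f2 \o a)%VF.
Proof.
by rewrite /gl_conj; split=> [<-|->]; rewrite ?lker0_compfVK ?lker0_compfK ?glP.
Qed.

(** Opaque on purpose: unfolding the embedding of endomorphisms into [GL S]
    makes the comparison of two elements of that group intractable. *)
Lemma gl_of_subproof f : {a : GL S |
  forall f', (f' \o f)%VF = \1%VF -> glval a = f}.
Proof.
exists (insubd (1%g : GL S) f) => f' f'f; apply: insubdK.
apply/lker0P => u v fuv.
by rewrite -[u]id_lfunE -[v]id_lfunE -f'f !comp_lfunE fuv.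
Qed.

Definition gl_of f : GL S := sval (gl_of_subproof f).

Lemma gl_ofE f f' : (f' \o f)%VF = \1%VF -> glval (gl_of f) = f.
Proof. exact: (svalP (gl_of_subproof f)). Qed.

Lemma gl_scalar_subproof c : lker (mgval c *: \1%VF : 'End(S)) == 0%VS.
Proof.
apply/lker0P => u v; rewrite !lfun_simp => /(scalerI (mgP c)) //.
Qed.

Definition gl_scalar c : GL S := MkGL (gl_scalar_subproof c).

Lemma gl_scalarM : {morph gl_scalar : c d / (c * d)%g}.
Proof.
move=> c d; apply: gl_inj.
by rewrite glM /= -comp_lfunZl comp_lfun1l scalerA.
Qed.

Lemma gl_scalar1 : gl_scalar 1%g = 1%g.
Proof. by apply: gl_inj; rewrite /= scale1r. Qed.

Lemma gl_scalarV c : gl_scalar c^-1%g = (gl_scalar c)^-1%g.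
Proof. by apply: (mulgI (gl_scalar c)); rewrite -gl_scalarM !mulgV gl_scalar1. Qed.

Lemma gl_scalarE c a : glval (gl_scalar c * a)%g = mgval c *: glval a.
Proof. by rewrite glM /= -comp_lfunZl comp_lfun1l. Qed.

Lemma gl_scalarC c a : (gl_scalar c * a = a * gl_scalar c)%g.
Proof.
by apply: gl_inj; rewrite gl_scalarE glM /= -comp_lfunZr comp_lfun1r.
Qed.

Definition gl_opp1 : GL S := gl_scalar (mg_opp1 F).

Lemma gl_opp1C a : (gl_opp1 * a = a * gl_opp1)%g.
Proof. exact: gl_scalarC. Qed.

Lemma gl_opp1M : (gl_opp1 * gl_opp1 = 1)%g.
Proof. by rewrite -gl_scalarM mg_opp1M gl_scalar1. Qed.

Lemma gl_opp1K a : (gl_opp1 * (gl_opp1 * a) = a)%g.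
Proof. by rewrite mulgA gl_opp1M mul1g. Qed.

Lemma gl_opp1_val : glval gl_opp1 = - \1%VF.
Proof. by rewrite /gl_opp1 /= scaleN1r. Qed.

Lemma gl_opp1E a : glval (gl_opp1 * a)%g = - glval a.
Proof. by rewrite gl_scalarE scaleN1r. Qed.

Hypothesis S0 : (0 < \dim {:S})%N.

Lemma lfun1_neq0 : (\1%VF : 'End(S)) != 0.
Proof.
move: S0; rewrite lt0n dimv_eq0; apply: contraNneq => E; rewrite -subv0.
apply/subvP => u _; rewrite memv0.
by rewrite -[u]id_lfunE E lfunE.
Qed.

Lemma scalar_lfun_inj (k l : F) : k *: (\1%VF : 'End(S)) = l *: \1%VF -> k = l.
Proof. exact: scaler_injr lfun1_neq0. Qed.

Lemma glval_neq0 a : glval a != 0.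
Proof.
apply: contraNneq lfun1_neq0 => a0.
by rewrite -(lker0_compfV (glP a)) a0 comp_lfun0l.
Qed.

End LinearGroup.

Lemma mem_Pin (R : realType) (V : vectType R) (h : V -> R)
    (Cl : clifford_algebra h) (S : vectType R[i]) (g : rep Cl S) v (a : GL S) :
  h v = 1 \/ h v = -1 -> glval a = g (cl_in Cl v) -> sg_set (Pin g) a.
Proof.
move=> hv aE; apply: sub_generated; split; first by exists v.
rewrite aE -repM cl_sq.
by case: hv => ->; [left|right]; rewrite repZ rep1 ?rmorphN rmorph1 ?scaleN1r ?scale1r.
Qed.

(** * Words in an orthonormal frame *)

Section Words.
Variables (R : realType) (V : vectType R) (h : V -> R) (hq : quadratic_form h).
Variables (Cl : clifford_algebra h).
Variables (e : (\dim {:V}).-tuple V) (eO : orthonormal_frame h e).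
Local Notation E i := (cl_in Cl (tnth e i)).
Implicit Types (s : seq 'I_(\dim {:V})).

Definition word s : Cl := \prod_(i <- s) E i.

Lemma frame_sq i : E i * E i = 1 \/ E i * E i = -1.
Proof.
by rewrite cl_sq; case: (eO.1 i) => ->; [left|right]; rewrite ?scaleN1r ?scale1r.
Qed.

Lemma frame_anticomm i j : i != j -> E i * E j = - (E j * E i).
Proof.
move=> ij; apply/eqP; rewrite -addr_eq0 clifford_anticomm eO.2 //.
by rewrite scale0r.
Qed.

Lemma clifford_signC (x y : Cl) n : x * ((-1) ^+ n * y) = (-1) ^+ n * (x * y).
Proof.
rewrite !mulrA.
by have -> : x * (-1) ^+ n = (-1) ^+ n * x by exact: commr_sign.
Qed.

(** One sign for each letter other than [i].  Only parities matter, so that the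
    number of occurrences of [i] is added rather than subtracted. *)
Lemma word_comm i s :
  E i * word s = (-1) ^+ (size s + count_mem i s) * (word s * E i).
Proof.
elim: s => [|j s IH] /=; first by rewrite /word big_nil mulr1 !mul1r.
rewrite /word big_cons -/(word s); have [->|ij] := eqVneq j i.
  rewrite -[in RHS]mulrA IH ?eqxx addSn addnS !exprS !mulN1r opprK.
  exact: clifford_signC.
rewrite mulrA frame_anticomm 1?eq_sym // mulNr -[_ * _ * word s]mulrA IH addSn.
rewrite add0n exprS mulN1r mulNr; congr (- _).
by rewrite clifford_signC !mulrA.
Qed.

Lemma word_sq s : word s * word s = 1 \/ word s * word s = -1.
Proof.
elim: s => [|i s IH]; first by left; rewrite /word big_nil mulr1.
rewrite /word big_cons -/(word s).
have EE : word s * E i = (-1) ^+ (size s + count_mem i s) * (E i * word s).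
  by rewrite word_comm mulrA -exprD addnn -mul2n exprM sqrrN !expr1n mul1r.
have -> : E i * word s * (E i * word s) =
    (-1) ^+ (size s + count_mem i s) * ((E i * E i) * (word s * word s)).
  rewrite -mulrA [word s * (_ * _)]mulrA EE -!mulrA.
  exact: clifford_signC.
have sgE n : ((-1) ^+ n : Cl) = 1 \/ ((-1) ^+ n : Cl) = -1.
  by rewrite -signr_odd; case: odd; [right|left].
by case: (sgE (size s + count_mem i s)%N) => ->; case: (frame_sq i) => ->;
  case: IH => ->; rewrite ?(mulrN, mulNr, mulr1, mul1r, opprK); by [left|right].
Qed.

Inductive word_span : Cl -> Prop :=
| span_word s : word_span (word s)
| span_lin a x y : word_span x -> word_span y -> word_span (a *: x + y).

(** Left multiplication by a vector preserves the span of the words, hence so does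
    left multiplication by any element, which is then applied to 1. *)
Lemma word_spanP x : word_span x.
Proof.
suff: forall z, word_span z -> word_span (x * z).
  by move=> /(_ (word [::]) (span_word _)); rewrite /word big_nil mulr1.
apply: (@clifford_ind _ _ _ Cl
  (fun x => forall z, word_span z -> word_span (x * z))) x => [|v|x y Px Py|a x y Px Py] z sz.
- by rewrite mul1r.
- have EW i : word_span (E i * z).
    elim: z / sz => [s|a u w _ IHu _ IHw].
      by have := span_word (i :: s); rewrite /word big_cons.
    by rewrite mulrDr -scalerAr; exact: span_lin.
  have [k ->] := frame_expand hq eO v.
  rewrite linear_sum mulr_suml.
  have s0 : word_span 0 by rewrite -(addNr z) -scaleN1r; exact: span_lin.
  apply: (big_ind word_span) => [//|u w su sw|i _].
    by rewrite -[u]scale1r; exact: span_lin.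
  by rewrite linearZ -scalerAl -[_ *: _]addr0; exact: span_lin.
- by rewrite -mulrA; apply/Px/Py.
- by rewrite mulrDl -scalerAl; apply: span_lin; [exact: Px|exact: Py].
Qed.

End Words.

(** * Vectors as endomorphisms *)

Section RepVectors.
Variables (R : realType) (V : vectType R) (h : V -> R).
Variables (Cl : clifford_algebra h) (S : vectType R[i]) (g : rep Cl S).
Local Notation gv v := (g (cl_in Cl v)).
Implicit Types (u v w : V) (a b : GL S).

Lemma rep_linear (k : R) x y : g (k *: x + y) = k%:C%C *: g x + g y.
Proof. by rewrite repD repZ. Qed.

Lemma rep0 : g 0 = 0.
Proof. by apply: (addrI (g 0)); rewrite -repD !addr0. Qed.

Lemma repN x : g (- x) = - g x.
Proof. by apply: (addrI (g x)); rewrite -repD !subrr rep0. Qed.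

Lemma rep_scalar (k : R) : g k%:A = k%:C%C *: \1%VF.
Proof. by rewrite repZ rep1. Qed.

Lemma rep_vecD u v : gv (u + v) = gv u + gv v.
Proof. by rewrite linearD repD. Qed.

Lemma rep_vecZ k v : gv (k *: v) = k%:C%C *: gv v.
Proof. by rewrite linearZ repZ. Qed.

Lemma rep_vecN v : gv (- v) = - gv v.
Proof. by rewrite linearN repN. Qed.

Lemma rep_vec_sq v : (gv v \o gv v)%VF = (h v)%:C%C *: \1%VF.
Proof. by rewrite -repM cl_sq rep_scalar. Qed.

Lemma rep_vec_anticomm u v :
  ((gv u \o gv v) + (gv v \o gv u))%VF = (polar h u v)%:C%C *: \1%VF.
Proof. by rewrite -!repM -repD clifford_anticomm rep_scalar. Qed.

Lemma comm_rep (w : 'End(S)) : (forall v, (w \o gv v = gv v \o w)%VF) ->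
  forall x, (w \o g x = g x \o w)%VF.
Proof.
move=> wV; apply: clifford_ind => [|//|x y wx wy|k x y wx wy].
- by rewrite rep1 comp_lfun1l comp_lfun1r.
- by rewrite repM comp_lfunA wx -comp_lfunA wy comp_lfunA.
- by rewrite rep_linear comp_lfunDr comp_lfunDl -comp_lfunZr -comp_lfunZl wx wy.
Qed.

Definition stableV a := forall v, exists v', gl_conj a (gv v) = gv v'.

Lemma lpin_stableV a : sg_set (Lpin g) a -> stableV a.
Proof.
move=> La v; have : Vimg g (gl_conj a (gv v)).
  by rewrite -La; exists (gv v) => //; exists v.
by case=> v' _ E; exists v'.
Qed.

Lemma stableV_lpin a : stableV a -> stableV a^-1%g -> sg_set (Lpin g) a.
Proof.
move=> aV aV'; apply/seteqP; split=> w.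
  by case=> _ [v _ <-] <-; have [v' ->] := aV v; exists v'.
case=> v _ <-; have [v' E] := aV' v; exists (gv v'); first by exists v'.
by rewrite -E gl_conjVK.
Qed.

Lemma gl_conj_scalar c (f : 'End(S)) : gl_conj (gl_scalar S c) f = f.
Proof.
by apply/gl_conjP; rewrite /= -comp_lfunZl -comp_lfunZr comp_lfun1l comp_lfun1r.
Qed.

(** A square that is scalar makes [a] and its inverse act alike on endomorphisms,
    so that one inclusion between [a V a^-1] and [V] suffices. *)
Lemma stableV_sq a c : (a * a = gl_scalar S c)%g -> stableV a ->
  sg_set (Lpin g) a.
Proof.
move=> aa aV; apply: (stableV_lpin aV) => v.
have -> : (a^-1 = gl_scalar S c^-1 * a)%g.
  by apply: (mulgI a); rewrite mulgV mulgA -gl_scalarC -mulgA aa -gl_scalarM mulVg gl_scalar1.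
by rewrite gl_conjM gl_conj_scalar; exact: aV.
Qed.

Lemma scalar_lpin c : sg_set (Lpin g) (gl_scalar S c).
Proof. by apply: stableV_lpin => v; exists v; rewrite -?gl_scalarV gl_conj_scalar. Qed.

Lemma centralV_lpin a :
  (forall v, gl_conj a (gv v) = gv v) -> sg_set (Lpin g) a.
Proof.
move=> aV; apply: stableV_lpin => v; exists v; rewrite // -{1}(aV v).
exact: gl_conjK.
Qed.

Lemma real_mg_subproof (k : R) : k != 0 -> k%:C%C != 0 :> R[i].
Proof. by rewrite fmorph_eq0. Qed.

Lemma gl_of_vecE v : h v != 0 -> glval (gl_of (gv v)) = gv v.
Proof.
move=> hv; apply: (@gl_ofE _ _ _ ((h v)^-1%:C%C *: gv v)).
by rewrite -comp_lfunZl rep_vec_sq scalerA -rmorphM /= mulVf // scale1r.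
Qed.

Lemma gl_of_vecM v : h v != 0 -> exists c, (gl_of (gv v) * gl_of (gv v))%g = gl_scalar S c.
Proof.
move=> hv; exists (MulGrp (real_mg_subproof hv)).
by apply: gl_inj; rewrite glM gl_of_vecE //= rep_vec_sq.
Qed.

(** Conjugation by a vector is the opposite of the reflection in it. *)
Lemma gl_conj_vec u v : h u != 0 ->
  gl_conj (gl_of (gv u)) (gv v) = - gv (v - (polar h u v / h u) *: u).
Proof.
move=> hu; apply/gl_conjP; rewrite gl_of_vecE // comp_lfunNl rep_vecD rep_vecN rep_vecZ.
rewrite comp_lfunDl comp_lfunNl -comp_lfunZl rep_vec_sq scalerA -rmorphM /= divfK //.
by rewrite -rep_vec_anticomm opprB addrK.
Qed.

Lemma vec_lpin v : h v != 0 -> sg_set (Lpin g) (gl_of (gv v)).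
Proof.
move=> hv; have [c /stableV_sq] := gl_of_vecM hv; apply => w.
by eexists; rewrite gl_conj_vec // -rep_vecN.
Qed.

Hypothesis S0 : (0 < \dim {:S})%N.

Lemma Pin_ind (P : GL S -> Prop) :
  P 1%g -> (forall a b, P a -> P b -> P (a * b)%g) ->
  (forall a, P a -> P a^-1%g) ->
  (forall v, h v = 1 \/ h v = -1 -> P (gl_of (gv v))) ->
  forall a, sg_set (Pin g) a -> P a.
Proof.
move=> P1 PM PV Pv; apply: generated_ind => // a [[v _ vE] aa].
have hv : h v = 1 \/ h v = -1.
  rewrite -vE rep_vec_sq in aa; case: aa => E; [left|right].
    move: E; rewrite -[RHS]scale1r => /(scalar_lfun_inj S0) E.
    by apply: (@complexI R); rewrite E.
  move: E; rewrite -[RHS]scaleN1r => /(scalar_lfun_inj S0) E.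
  by apply: (@complexI R); rewrite E rmorphN.
suff -> : a = gl_of (gv v) by exact: Pv.
apply: gl_inj; rewrite -vE gl_of_vecE //.
by case: hv => ->; rewrite ?oppr_eq0 oner_eq0.
Qed.

Lemma unit_neq0 v : h v = 1 \/ h v = -1 -> h v != 0.
Proof. by case=> ->; rewrite ?oppr_eq0 oner_eq0. Qed.

Lemma gl_of_vec_Pin v : h v = 1 \/ h v = -1 -> sg_set (Pin g) (gl_of (gv v)).
Proof. by move=> hv; apply: (mem_Pin hv); rewrite gl_of_vecE ?unit_neq0. Qed.

Lemma Pin_lpin a : sg_set (Pin g) a -> sg_set (Lpin g) a.
Proof.
apply: Pin_ind; [exact: sg1|exact: sgM|exact: sgV|].
by move=> v /unit_neq0; exact: vec_lpin.
Qed.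

End RepVectors.

(** * Parity in the Pin group *)

Section Twist.
Variables (R : realType) (V : vectType R) (h : V -> R).
Variables (Cl : clifford_algebra h) (S : vectType R[i]) (g : rep Cl S).
Hypothesis S0 : (0 < \dim {:S})%N.
Local Notation gv v := (g (cl_in Cl v)).
Local Notation Pin := (Pin g).
Local Notation N := (gl_opp1 S).
Variable T : GL S.
Hypothesis TV : forall v, (T \o gv v)%VF = - (gv v \o T)%VF.
Implicit Types (u v w : V) (a b p q : GL S).

Lemma grading_in v : grading Cl (cl_in Cl v) = - cl_in Cl v.
Proof. exact: (projT2 (cid (grading_ex Cl))). Qed.

Lemma gradingM x y : grading Cl (x * y) = grading Cl x * grading Cl y.
Proof. exact: rmorphM. Qed.

Lemma gradingN x : grading Cl (- x) = - grading Cl x.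
Proof. exact: (@raddfN Cl Cl (grading Cl)). Qed.

Lemma grading1 : grading Cl 1 = 1.
Proof. exact: rmorph1. Qed.

(** [T] implements the grading automorphism, as it does so on vectors. *)
Lemma twist_rep x : (T \o g x = g (grading Cl x) \o T)%VF.
Proof.
elim/clifford_ind: x => [|v|x y Px Py|k x y Px Py].
- by rewrite rmorph1 rep1 comp_lfun1l comp_lfun1r.
- by rewrite grading_in repN comp_lfunNl.
- by rewrite rmorphM !repM comp_lfunA Px -[LHS]comp_lfunA Py comp_lfunA.
- by rewrite linearP !rep_linear comp_lfunDr comp_lfunDl -comp_lfunZr -comp_lfunZl Px Py.
Qed.

(** Parity is read off from commutation with [T] inside [GL S], so that no
    preimage in the Clifford algebra has to be chosen. *)
Definition even_gl p := (T * p = p * T)%g.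
Definition odd_gl p := (T * p = N * p * T)%g.

Lemma even_glP p : even_gl p <-> (T \o p)%VF = (p \o T)%VF.
Proof. by rewrite /even_gl; split=> [/(congr1 (@glval _ S))|EE]; [|exact: gl_inj]. Qed.

Lemma odd_glP p : odd_gl p <-> (T \o p)%VF = - (p \o T)%VF.
Proof.
have E : glval (N * p * T)%g = - (p \o T)%VF by rewrite -mulgA gl_opp1E.
by rewrite /odd_gl; split=> [/(congr1 (@glval _ S))|EE]; [rewrite E | apply: gl_inj; rewrite E].
Qed.

Lemma gl_opp1_neq1 : N <> 1%g.
Proof.
move=> /(congr1 (@glval _ S)) /= E; have := scalar_lfun_inj S0 (etrans E (esym (scale1r _))).
by move/eqP; rewrite eqNr oner_eq0.
Qed.

Lemma even_odd_absurd p : even_gl p -> odd_gl p -> False.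
Proof.
rewrite /even_gl /odd_gl => -> /(mulIg T); rewrite -{1}[p]mul1g => /(mulIg p).
by move/esym/gl_opp1_neq1.
Qed.

Lemma even_gl1 : even_gl 1%g. Proof. by rewrite /even_gl mulg1 mul1g. Qed.

Lemma even_glM p q : even_gl p -> even_gl q -> even_gl (p * q)%g.
Proof. by rewrite /even_gl => P Q; rewrite mulgA P -mulgA Q mulgA. Qed.

Lemma even_odd_glM p q : even_gl p -> odd_gl q -> odd_gl (p * q)%g.
Proof. by rewrite /even_gl /odd_gl => P Q; rewrite mulgA P -mulgA Q !mulgA gl_opp1C. Qed.

Lemma odd_even_glM p q : odd_gl p -> even_gl q -> odd_gl (p * q)%g.
Proof. by rewrite /even_gl /odd_gl => P Q; rewrite mulgA P -mulgA Q !mulgA. Qed.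

Lemma odd_glM p q : odd_gl p -> odd_gl q -> even_gl (p * q)%g.
Proof.
rewrite /even_gl /odd_gl => P Q; rewrite mulgA P -mulgA Q -!mulgA.
by rewrite [(p * (N * _))%g]mulgA -gl_opp1C -!mulgA gl_opp1K.
Qed.

Lemma even_gl_twist : even_gl T. Proof. by []. Qed.

Lemma odd_gl_vec v : h v != 0 -> odd_gl (gl_of (gv v)).
Proof. by move=> hv; apply/odd_glP; rewrite gl_of_vecE. Qed.

(** Both members are closed under products, and the inverse of a unit vector is
    that vector up to a sign, so that inverses raise no further case. *)
Lemma Pin_parity p : sg_set Pin p ->
  exists2 x, glval p = g x &
    (grading Cl x = x /\ even_gl p) \/ (grading Cl x = - x /\ odd_gl p).
Proof.
pose P p := exists2 x, glval p = g x &
    (grading Cl x = x /\ even_gl p) \/ (grading Cl x = - x /\ odd_gl p).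
have PM a b : P a -> P b -> P (a * b)%g.
  move=> [x ax xa] [y bx yb]; exists (x * y); first by rewrite glM ax bx repM.
  rewrite gradingM; case: xa yb => -[-> xa] [[-> yb]|[-> yb]]; rewrite ?mulrNN ?mulrN ?mulNr.
  - by left; split=> //; exact: even_glM.
  - by right; split=> //; exact: even_odd_glM.
  - by right; split=> //; exact: odd_even_glM.
  - by left; split=> //; exact: odd_glM.
have P1 : P 1%g.
  by exists 1; [rewrite rep1 | left; split; [exact: grading1 | exact: even_gl1]].
have PN : P N.
  exists (- 1); first by rewrite repN rep1 /= scaleN1r.
  by left; split; [rewrite gradingN grading1 | rewrite /even_gl gl_opp1C].
suff : sg_set Pin p -> P p /\ P p^-1%g by move=> H /H[].
move: p; apply: (Pin_ind S0 (P := fun p => P p /\ P p^-1%g)) =>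
  [|a b [pa pa'] [pb pb']|a [pa pa']|v hv].
- by split; rewrite ?invg1.
- by split; rewrite ?invgM; exact: PM.
- by split; rewrite ?invgK.
have Pv : P (gl_of (gv v)).
  exists (cl_in Cl v); first exact/gl_of_vecE/unit_neq0.
  by right; split; [exact: grading_in | exact/odd_gl_vec/unit_neq0].
split=> //; set a := gl_of _ in Pv *.
have [aa|aa] : (a * a = 1)%g \/ (a * a = N)%g.
  have aE : glval (a * a)%g = (h v)%:C%C *: \1%VF.
    by rewrite glM gl_of_vecE ?rep_vec_sq ?unit_neq0.
  case: hv aE => -> aE; [left|right]; apply: gl_inj; rewrite aE.
    by rewrite rmorph1 scale1r.
  by rewrite rmorphN rmorph1 gl_opp1_val scaleN1r.
- by have -> : a^-1%g = a by apply: (mulgI a); rewrite mulgV aa.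
have -> : a^-1%g = (N * a)%g.
  by apply: (mulgI a); rewrite mulgV mulgA -gl_opp1C -mulgA aa gl_opp1M.
exact: PM.
Qed.

Lemma Pin_even p : sg_set Pin p -> even_gl p <-> in_Cl_even g p.
Proof.
move=> /Pin_parity[x px xp]; split=> [pe|[y ay py]].
  by exists x => //; case: xp => -[// _ /(even_odd_absurd pe)].
by apply/even_glP; rewrite {1}py twist_rep ay -py.
Qed.

Lemma Pin_even_or_odd p : sg_set Pin p -> even_gl p \/ odd_gl p.
Proof. by move=> /Pin_parity[x _ []] []; [left|right]. Qed.

Lemma mem_Spin p : sg_set (Spin g) p <-> sg_set Pin p /\ even_gl p.
Proof. by split=> -[Pp pe]; split=> //; apply/(Pin_even Pp). Qed.

End Twist.

(** * Reflections and the Lipschitz group *)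

Section Reflections.
Variables (R : realType) (V : vectType R) (h : V -> R) (hq : quadratic_form h).
Variables (Cl : clifford_algebra h) (S : vectType R[i]) (g : rep Cl S).
Hypothesis S0 : (0 < \dim {:S})%N.
Local Notation gv v := (g (cl_in Cl v)).
Local Notation Pin := (Pin g).
Local Notation N := (gl_opp1 S).
Variables (e : (\dim {:V}).-tuple V) (eO : orthonormal_frame h e).
Variable T : GL S.
Hypothesis TT : (T * T = N)%g.
Hypothesis TV : forall v, (T \o gv v)%VF = - (gv v \o T)%VF.
Implicit Types (u v w : V) (a b p q : GL S).
Local Notation even_gl := (even_gl T).
Local Notation odd_gl := (odd_gl T).

(** The factor [T] compensates the sign by which conjugation by an odd element
    differs from a product of reflections. *)
Definition twisted p : GL S := if `[< even_gl p >] then p else (p * T)%g.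

Lemma twisted_even p : even_gl p -> twisted p = p.
Proof. by move=> pe; rewrite /twisted asboolT. Qed.

Lemma twisted_odd p : odd_gl p -> twisted p = (p * T)%g.
Proof. by move=> po; rewrite /twisted asboolF // => /(even_odd_absurd S0); exact. Qed.

(** For odd [p] and [q], moving [T] across [q] costs a sign, and [T * T = -1]
    restores it. *)
Lemma twistedM p q : sg_set Pin p -> sg_set Pin q ->
  twisted (p * q)%g = (twisted p * twisted q)%g.
Proof.
move=> /(Pin_even_or_odd S0 TV)[pe|po] /(Pin_even_or_odd S0 TV)[qe|qo].
- by rewrite !twisted_even //; exact: even_glM.
- rewrite (twisted_odd (even_odd_glM pe qo)) (twisted_even pe) (twisted_odd qo).
  by rewrite mulgA.
- rewrite (twisted_odd (odd_even_glM po qe)) (twisted_odd po) (twisted_even qe).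
  by rewrite -!mulgA -qe.
- rewrite (twisted_even (odd_glM po qo)) (twisted_odd po) (twisted_odd qo).
  rewrite -mulgA [(T * (q * T))%g]mulgA qo -!mulgA TT.
  by rewrite -(gl_opp1C q) gl_opp1K.
Qed.

Lemma twist_lpin : sg_set (Lpin g) T.
Proof.
apply: stableV_sq TT _ => v; exists (- v).
by apply/gl_conjP; rewrite TV rep_vecN comp_lfunNl.
Qed.

Lemma gl_conj_twist v : gl_conj T (gv v) = - gv v.
Proof. by apply/gl_conjP; rewrite TV comp_lfunNl. Qed.

Lemma twisted_lpin p : sg_set Pin p -> sg_set (Lpin g) (twisted p).
Proof.
move=> Pp; have Lp := Pin_lpin S0 Pp.
rewrite /twisted; case: ifP => _; first exact: Lp.
exact: sgM Lp twist_lpin.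
Qed.

Definition refl u v := v - (polar h u v / h u) *: u.

Lemma twisted_unit u v : h u = 1 \/ h u = -1 ->
  gl_conj (twisted (gl_of (gv u))) (gv v) = gv (refl u v).
Proof.
move=> /unit_neq0 hu; rewrite (twisted_odd (odd_gl_vec TV hu)) gl_conjM gl_conj_twist.
by rewrite linearN /= gl_conj_vec // opprK.
Qed.

Lemma twisted_refl u : h u != 0 -> exists2 p, sg_set Pin p &
  forall v, gl_conj (twisted p) (gv v) = gv (refl u v).
Proof.
move=> hu; pose k := (Num.sqrt `|h u|)^-1; pose u' := k *: u.
have k0 : k != 0 by rewrite invr_eq0 sqrtr_eq0 -ltNge normr_gt0.
have hu' : h u' = k ^+ 2 * h u by exact: hq.1.
have hu1 : h u' = 1 \/ h u' = -1.
  rewrite hu' exprVn sqr_sqrtr //.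
  by have [?|?] := ger0P (h u); [left|right]; rewrite ?invrN ?mulNr mulVf.
exists (gl_of (gv u')); first exact: gl_of_vec_Pin.
move=> v; rewrite twisted_unit //; congr (gv _).
rewrite /refl hu' polarZl // /u' scalerA; congr (v - _ *: u).
by field; rewrite hu k0.
Qed.

(** The polar form is recovered from anticommutators, which conjugation
    preserves. *)
Lemma conj_polar a v v' w w' : gl_conj a (gv v) = gv v' ->
  gl_conj a (gv w) = gv w' -> polar h v' w' = polar h v w.
Proof.
move=> E F; have := congr1 (gl_conj a) (rep_vec_anticomm g v w).
rewrite linearD /= !gl_conj_comp E F rep_vec_anticomm linearZ /= gl_conj_id.
by move/(scalar_lfun_inj S0)/complexI.
Qed.

Lemma refl_ortho u v : polar h u v = 0 -> refl u v = v.
Proof. by move=> uv; rewrite /refl uv mul0r scale0r subr0. Qed.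

Lemma refl_sub v w : h v = h w -> h (v - w) != 0 -> refl (v - w) v = w.
Proof.
move=> hvw hu; rewrite /refl.
have -> : polar h (v - w) v = h (v - w).
  rewrite polarDl // polar_diag // polarNl // (qformD h) qformN // polarNr //.
  by rewrite (polarC h w) -hvw mulr2n.
by rewrite divff // scale1r opprB addrC subrK.
Qed.

(** If [h (y - x)] is nonzero, the reflection in [y - x] sends [y] to [x].
    Otherwise [h (y + x) = 4 h x], the reflection in [y + x] sends [y] to [- x],
    and the reflection in [x] sends [- x] to [x]. *)
Lemma refl_transport x y : h y = h x -> h x != 0 ->
  exists2 p, sg_set Pin p & gl_conj (twisted p) (gv y) = gv x /\
    forall v, polar h x v = 0 -> polar h y v = 0 ->
      gl_conj (twisted p) (gv v) = gv v.
Proof.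
move=> yx hx; have [d0|d0] := eqVneq (h (y - x)) 0; last first.
  have [p Pp pE] := twisted_refl d0.
  exists p => //; split=> [|v xv yv]; rewrite pE ?refl_sub //.
  by rewrite refl_ortho // polarDl // polarNl // xv yv oppr0 addr0.
have hs : h (y - - x) != 0.
  have E : h (y - - x) + h (y - x) = 4 * h x.
    by rewrite opprK (qformD h y x) (qformD h y (- x)) qformN // polarNr // yx; ring.
  by rewrite d0 addr0 in E; rewrite E mulf_neq0 // pnatr_eq0.
have [p Pp pE] := twisted_refl hs; have [q Pq qE] := twisted_refl hx.
exists (q * p)%g; first exact: sgM.
rewrite twistedM //; split=> [|v xv yv]; rewrite gl_conjM pE.
  rewrite refl_sub ?qformN // qE /refl polarNr // polar_diag //.
  rewrite mulNr -[h x *+ 2]mulr_natr mulrAC divff // mul1r scaleNr opprK.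
  by rewrite scaler_nat mulr2n addKr.
by rewrite refl_ortho ?qE ?refl_ortho // opprK polarDl // xv yv addr0.
Qed.

(** The frame vectors are put back in place one at a time.  The image of the next
    one is orthogonal to those already fixed, as is the vector itself, so the
    reflections exchanging the two leave the fixed ones alone. *)
Lemma cartan_dieudonne a : sg_set (Lpin g) a ->
  exists2 p, sg_set Pin p & forall v, gl_conj (twisted p * a)%g (gv v) = gv v.
Proof.
move=> La.
suff: forall k, (k <= \dim {:V})%N -> exists2 p, sg_set Pin p &
    forall i : 'I_(\dim {:V}), (i < k)%N ->
      gl_conj (twisted p * a)%g (gv (tnth e i)) = gv (tnth e i).
  move=> /(_ _ (leqnn _))[p Pp pE]; exists p => // v.
  have [k ->] := frame_expand hq eO v.
  elim/big_ind: _ => [|x y xE yE|i _]; first by rewrite linear0 rep0 linear0.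
    by rewrite rep_vecD linearD /= xE yE.
  by rewrite rep_vecZ linearZ /= pE.
elim=> [_|k IH kV]; first by exists 1%g; [exact: sg1|].
have [p Pp pE] := IH (ltnW kV); pose i0 := Ordinal kV.
have Lb : sg_set (Lpin g) (twisted p * a)%g by exact: sgM (twisted_lpin Pp) La.
have [y yE] := lpin_stableV Lb (tnth e i0).
have hy : h y = h (tnth e i0).
  have := conj_polar yE yE; rewrite !polar_diag // => /eqP.
  by rewrite eqrMn2r // => /eqP.
have [q Pq [qy qo]] := refl_transport hy (unit_neq0 (eO.1 i0)).
exists (q * p)%g => [|i]; first exact: sgM.
rewrite twistedM // -mulgA gl_conjM ltnS leq_eqVlt => /predU1P[ik|ik].
  have -> : i = i0 by apply: val_inj; rewrite /= ik.
  by rewrite yE.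
rewrite pE //; apply: qo; last rewrite (conj_polar yE (pE i ik)).
  by apply: eO.2; rewrite -val_eqE /= gtn_eqF.
by apply: eO.2; rewrite -val_eqE /= gtn_eqF.
Qed.

(** Everything in the Lipschitz group is thus controlled by the Pin group and by
    the commutant of the vectors. *)
Lemma lpin_decomp a : sg_set (Lpin g) a -> exists d p,
  [/\ sg_set Pin p, a = (d * twisted p)%g & forall v, gl_conj d (gv v) = gv v].
Proof.
move=> /sgV La; have [p Pp pE] := cartan_dieudonne La.
exists (twisted p * a^-1)^-1%g, p; split; first exact: Pp.
  by rewrite invgM invgK mulgVK.
by move=> v; rewrite -{1}pE gl_conjK.
Qed.

End Reflections.

(** * Scalars in the Pin group *)

Section PinScalars.
Variables (R : realType) (V : vectType R) (h : V -> R) (hq : quadratic_form h).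
Variables (Cl : clifford_algebra h) (S : vectType R[i]) (g : rep Cl S).
Hypothesis S0 : (0 < \dim {:S})%N.
Local Notation gv v := (g (cl_in Cl v)).
Local Notation Pin := (Pin g).
Variables (e : (\dim {:V}).-tuple V) (eO : orthonormal_frame h e).
Variable T : GL S.
Hypothesis TV : forall v, (T \o gv v)%VF = - (gv v \o T)%VF.
Implicit Types (s : seq 'I_(\dim {:V})).

Lemma grading_word s : grading Cl (word Cl e s) = (-1) ^+ size s * word Cl e s.
Proof.
elim: s => [|i s IH]; first by rewrite /word big_nil grading1 mulr1.
rewrite /word big_cons -/(word Cl e s) gradingM grading_in IH.
by rewrite clifford_signC exprS mulN1r !mulNr mulrN.
Qed.

Lemma rep_sign n x : g ((-1) ^+ n * x) = (-1) ^+ n *: g x.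
Proof.
by rewrite -signr_odd -[in RHS]signr_odd; case: odd;
  rewrite ?expr1 ?expr0 ?mulN1r ?mul1r ?scaleN1r ?scale1r ?repN.
Qed.

Lemma lfun_trZ c (f : 'End(S)) : lfun_tr (c *: f) = c * lfun_tr f.
Proof.
by rewrite -[c *: f]addr0 lfun_trP -[in X in _ + X](scale0r \1%VF) lfun_tr_scal mul0rn addr0.
Qed.

(** When the first letter [i] occurs again, the word is a shorter one up to sign.
    Otherwise the letter [i] occurs once.  If the rest has odd length,
    the first letter anticommutes with it, and the trace equals its opposite by
    cyclicity; if it has even length, the whole word is odd and conjugation by
    [T] changes its sign. *)
Lemma lfun_tr_word s : exists r : R, lfun_tr (g (word Cl e s)) = r%:C%C.
Proof.
have [n] := ubnP (size s); elim: n s => // n IH [_|i s].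
  exists (\dim {:S})%:R.
  by rewrite /word big_nil rep1 -[\1%VF]scale1r lfun_tr_scal rmorph_nat.
have [is_|is_] := boolP (i \in s).
  case/splitPr: is_ => s1 s2; rewrite /= size_cat /= addnS => lt_n.
  have [|r rE] := IH (s1 ++ s2); first by rewrite size_cat ltnW.
  have [k kE] : exists k, word Cl e (i :: s1 ++ i :: s2) =
      (-1) ^+ k * word Cl e (s1 ++ s2).
    rewrite /word big_cons !big_cat big_cons /= -!/(word Cl e _) mulrA.
    rewrite (word_comm Cl eO) -!mulrA [cl_in _ _ * (_ * _)]mulrA.
    case: (frame_sq Cl eO i) => ->; rewrite ?mul1r ?mulN1r ?mulrN.
      by eexists; congr (_ * _).
    by exists (size s1 + count_mem i s1).+1; rewrite exprS mulN1r mulNr.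
  exists ((-1) ^+ k * r).
  by rewrite kE rep_sign lfun_trZ rE rmorphM rmorph_sign.
move=> _; exists 0.
suff E : lfun_tr (g (word Cl e (i :: s))) = - lfun_tr (g (word Cl e (i :: s))).
  by apply/eqP; rewrite -eqNr -E.
have [so|so] := boolP (odd (size s)).
  rewrite {1}/word big_cons -/(word Cl e s) (word_comm Cl eO).
  rewrite rep_sign -signr_odd oddD so (count_memPn is_) /= expr1 scaleN1r.
  rewrite -scaleN1r lfun_trZ mulN1r /word big_cons -/(word Cl e s); congr (- _).
  by rewrite !repM lfun_tr_comp.
set w := word _ _ _.
have gw : grading Cl w = - w.
  by rewrite grading_word /= -signr_odd /= so expr1 mulN1r.
rewrite -[RHS]mulN1r -lfun_trZ scaleN1r -repN -gw.
(* The trace of g (grading w) is that of T \o g w \o T^-1. *)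
rewrite -[g (grading Cl w)]comp_lfun1r -(lker0_compfV (glP T)) comp_lfunA.
by rewrite -(twist_rep TV) lfun_tr_comp comp_lfunA lker0_compVf ?glP // comp_lfun1l.
Qed.

(** This is where the Clifford algebra being real is used: the words span it with
    real coefficients. *)
Lemma lfun_tr_rep x : exists r : R, lfun_tr (g x) = r%:C%C.
Proof.
elim: {x}(word_spanP hq eO x) => [s|a x y _ [r rE] _ [r' r'E]].
  exact: lfun_tr_word.
exists (a * r + r'); rewrite rep_linear lfun_trP rE r'E.
by rewrite rmorphD rmorphM.
Qed.

Lemma Pin_det p : sg_set Pin p -> lfun_det p ^+ 4 = 1.
Proof.
apply: (Pin_ind S0 (P := fun p => lfun_det p ^+ 4 = 1)) => [|a b aE bE|a aE|v hv].
- by rewrite -[glval _]scale1r lfun_det_scal !expr1n.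
- by rewrite lfun_det_comp exprMn aE bE mulr1.
- have /(congr1 (fun f => lfun_det f ^+ 4)) := lker0_compfV (glP a).
  by rewrite lfun_det_comp exprMn aE mul1r -[X in _ = lfun_det X ^+ _]scale1r lfun_det_scal !expr1n.
rewrite (exprM _ 2 2) [lfun_det _ ^+ 2]expr2 -lfun_det_comp gl_of_vecE ?unit_neq0 // rep_vec_sq.
(* The square of a unit vector is 1 or -1, hence its determinant as well. *)
rewrite lfun_det_scal -exprM mulnC exprM.
have -> : (h v)%:C%C ^+ 2 = 1 :> R[i].
  by case: hv => ->; rewrite ?rmorphN ?sqrrN rmorph1 expr1n.
by rewrite expr1n.
Qed.

(** The trace of [p] is real, hence so is [c]; its determinant is a root of unity,
    hence so is [c]. *)
Lemma Pin_scalar p c : sg_set Pin p -> glval p = c *: \1%VF -> c = 1 \/ c = -1.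
Proof.
move=> Pp pc; have [x px _] := Pin_parity S0 TV Pp.
have n0 : (\dim {:S})%:R != 0 :> R[i] by rewrite pnatr_eq0 -lt0n.
have [r cr] : exists r : R, c = r%:C%C.
  have [r] := lfun_tr_rep x.
  rewrite -px pc lfun_tr_scal -mulr_natr => /(canRL (mulfK n0)) ->.
  by exists (r / (\dim {:S})%:R); rewrite rmorphM fmorphV rmorph_nat.
have := Pin_det Pp; rewrite pc lfun_det_scal -exprM cr -rmorphXn => /complexI.
move/(congr1 Num.norm); rewrite normrX normr1 => /eqP.
rewrite pexpr_eq1 ?muln_gt0 ?S0 // => /eqP.
case: (ger0P r) => _; first by move=> ->; left; rewrite rmorph1.
by move/(canRL opprK) => ->; right; rewrite rmorphN rmorph1.
Qed.

End PinScalars.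

(** * The action on endomorphisms anticommuting with vectors *)

Section Common.
Variables (R : realType) (V : vectType R) (h : V -> R) (hq : quadratic_form h).
Variables (Cl : clifford_algebra h) (S : vectType R[i]) (g : rep Cl S).
Hypothesis S0 : (0 < \dim {:S})%N.
Local Notation gv v := (g (cl_in Cl v)).
Local Notation Pin := (Pin g).
Local Notation Lpin := (Lpin g).
Local Notation N := (gl_opp1 S).
Variables (e : (\dim {:V}).-tuple V) (eO : orthonormal_frame h e).
Variable T : GL S.
Hypothesis TT : (T * T = N)%g.
Hypothesis TV : forall v, (T \o gv v)%VF = - (gv v \o T)%VF.
Local Notation even_gl := (even_gl T).
Local Notation odd_gl := (odd_gl T).
Implicit Types (a b p q : GL S).

Section CdotMap.
Variables (G : subgroup (GL S)) (GPin : forall p, sg_set G p -> sg_set Pin p).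

Definition cdot_fun (x : mulgrp R[i] * G) : Lpin :=
  sg_in (sgM (scalar_lpin g x.1) (Pin_lpin S0 (GPin (sgP x.2)))).

Lemma cdot_funE x : sgval (cdot_fun x) = (gl_scalar S x.1 * sgval x.2)%g.
Proof. by []. Qed.

Lemma cdot_funM : {morph cdot_fun : x y / (x * y)%g}.
Proof.
move=> [l p] [k q]; apply: val_inj.
rewrite [LHS]/= [RHS]/= gl_scalarM -!mulgA; congr (_ * _)%g.
by rewrite !mulgA gl_scalarC.
Qed.

(** A pair [(l, p)] is mapped to 1 only if [p] is the scalar inverse to [l], and
    the scalars of the Pin group are 1 and -1. *)
Lemma cdot_map_ex :
  exists2 i : {multiplicative Cdot G -> Lpin}, injective i & Cdot_map i.
Proof.
have [x [l1 p1]|[l p] lp1|i [iI iE]] :=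
  @quo_lift _ _ [set x : mulgrp R[i] * G |
    mgval x.1 = -1 /\ glval (sgval x.2) = - \1%VF]%classic (hom_of cdot_funM).
- apply/val_inj/gl_inj.
  by rewrite [val _]cdot_funE gl_scalarE l1 p1 scaleN1r opprK.
- have lp : mgval l *: glval (sgval p) = \1%VF.
    have E : sgval (cdot_fun (l, p)) = 1%g.
      by rewrite -[cdot_fun _]/(hom_of cdot_funM (l, p)) lp1.
    by rewrite -gl_scalarE -[RHS]/(glval (1%g : GL S)) -E cdot_funE.
  have pE : glval (sgval p) = (mgval l)^-1 *: \1%VF.
    by rewrite -[\1%VF]lp scalerA mulVf ?mgP // scale1r.
  have [l1|l1] := Pin_scalar hq S0 eO TV (GPin (sgP p)) pE.
    left; have -> : l = 1%g by apply: mg_inj; rewrite /= -[LHS]invrK l1 invr1.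
    congr pair; apply/val_inj/gl_inj.
    by rewrite [LHS]pE l1 scale1r.
  right; split => /=; first by rewrite -[LHS]invrK l1 invrN invr1.
  by rewrite pE l1 scaleN1r.
exists i => // l p; rewrite iE [hom_of _ _]/= cdot_funE.
by rewrite gl_scalarE.
Qed.

Lemma cdot_image (i : {multiplicative Cdot G -> Lpin}) (a : Lpin) :
  Cdot_map i -> (exists x, i x = a) <->
    exists l, exists2 p, sg_set G p & sgval a = (gl_scalar S l * p)%g.
Proof.
move=> iE; split=> [[x <-]|[l [p Gp aE]]].
  rewrite -[x]reprqK; case: (repr x) => l p.
  exists l; exists (sgval p); first exact: sgP.
  by apply: gl_inj; rewrite iE gl_scalarE.
exists (toquo _ (l, sg_in Gp)); apply/val_inj/gl_inj.
by rewrite [LHS]iE [RHS](congr1 (@glval _ S) aE) gl_scalarE.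
Qed.

End CdotMap.

Lemma Spin_Pin p : sg_set (Spin g) p -> sg_set Pin p.
Proof. by case. Qed.

Lemma centralV_comm (d : GL S) : (forall v, gl_conj d (gv v) = gv v) <->
  forall v, (d \o gv v = gv v \o d)%VF.
Proof. by split=> H v; apply/gl_conjP. Qed.

Lemma even_gl_conj a : gl_conj a T = T <-> even_gl a.
Proof.
by split=> [/gl_conjP E|/even_glP E]; [apply/even_glP; rewrite E|apply/gl_conjP; rewrite E].
Qed.

Lemma odd_gl_conj a : gl_conj a T = - glval T <-> odd_gl a.
Proof.
split=> [/gl_conjP E|/odd_glP E]; [apply/odd_glP|apply/gl_conjP]; last first.
  by rewrite comp_lfunNl E opprK.
by rewrite E comp_lfunNl opprK.
Qed.

Lemma even_gl_scalar l : even_gl (gl_scalar S l).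
Proof. by rewrite /even_gl gl_scalarC. Qed.


(** Elements of the orthogonal group act on A(h) as a type of its own; projecting
    onto A(h) first lets all computations take place in [End S]. *)
Definition act (f : Oh0 g) (w : 'End(S)) : 'End(S) :=
  vsval (glval (sgval f) (vsproj (Ah g) w)).

Lemma act_in f w : act f w \in Ah g.
Proof. exact: subvsP. Qed.

Lemma act_kappa (a : Lpin) w : w \in Ah g -> act (kappa g a) w = gl_conj (sgval a) w.
Proof. by move=> wA; rewrite /act kappaE vsprojK. Qed.

Lemma actM f f' w : act (f * f')%g w = act f (act f' w).
Proof. by rewrite /act vsvalK -comp_lfunE. Qed.

Lemma act1 w : w \in Ah g -> act 1%g w = w.
Proof. by move=> wA; rewrite /act id_lfunE vsprojK. Qed.

Lemma act_linear f k u w : act f (k *: u + w) = k *: act f u + act f w.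
Proof. by rewrite /act !linearP. Qed.

Lemma actZ f k u : act f (k *: u) = k *: act f u.
Proof. by rewrite /act !linearZ. Qed.

Lemma act_ext f f' : (forall w, w \in Ah g -> act f w = act f' w) -> f = f'.
Proof.
move=> ff'; apply/val_inj/gl_inj/lfunP => w; apply: val_inj.
by have := ff' _ (subvsP w); rewrite /act vsvalK.
Qed.

Lemma h0_act f w : w \in Ah g -> h0 (act f w) = h0 w.
Proof. by move=> wA; have /(_ (vsproj _ w)) := sgP f; rewrite vsprojK. Qed.

Lemma h0E (w : 'End(S)) l : (w \o w)%VF = l *: \1%VF -> h0 w = l.
Proof.
move=> wl; apply: xget_unique => // y /=; rewrite wl.
by move/(scalar_lfun_inj S0).
Qed.

Lemma twist_Ah : glval T \in Ah g.
Proof. by apply/memAhP => v; rewrite TV addNr. Qed.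

Lemma comm_twist_Ah w : (forall v, (w \o gv v = gv v \o w)%VF) ->
  (w \o T)%VF \in Ah g.
Proof.
move=> wV; apply/memAhP => v.
by rewrite -comp_lfunA TV comp_lfunNr comp_lfunA wV comp_lfunA addNr.
Qed.

(** Composition with [T] exchanges commuting and anticommuting with vectors, so
    A(h) is determined by the commutant. *)
Lemma Ah_comm_twist w : w \in Ah g -> exists2 d : 'End(S),
  (forall v, (d \o gv v = gv v \o d)%VF) & w = (d \o T)%VF.
Proof.
move=> /memAhP wV; exists (w \o glval T^-1%g)%VF => [v|]; last first.
  by rewrite -comp_lfunA lker0_compVf ?glP // comp_lfun1r.
have TV' : (glval T^-1%g \o gv v)%VF = - (gv v \o glval T^-1%g)%VF.
  have -> : T^-1%g = (N * T)%g.
    by apply: (mulgI T); rewrite mulgV mulgA -gl_opp1C -mulgA TT gl_opp1M.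
  by rewrite gl_opp1E comp_lfunNl TV comp_lfunNr.
rewrite -comp_lfunA TV' comp_lfunNr comp_lfunA.
have /eqP := wV v; rewrite addr_eq0 => /eqP ->.
by rewrite comp_lfunNl opprK comp_lfunA.
Qed.

Lemma twist_sq : (T \o T)%VF = - \1%VF.
Proof. by rewrite -glM TT gl_opp1_val. Qed.

End Common.

(** * Even dimension *)

Section Z2Facts.
Variable F : fieldType.

Definition Z2_opp1 : Z2 F := @sg_in _ (Z2 F) (mg_opp1 F) (or_intror erefl).

Lemma Z2_cases (x : Z2 F) : x = 1%g \/ x = Z2_opp1.
Proof. by case: (sgP x) => E; [left|right]; apply: val_inj. Qed.

Lemma Z2_opp1M : (Z2_opp1 * Z2_opp1)%g = 1%g.
Proof. by apply: val_inj; exact: mg_opp1M. Qed.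

Lemma Z2_valM (x y : Z2 F) :
  mgval (sgval (x * y)%g) = mgval (sgval x) * mgval (sgval y).
Proof. by []. Qed.

Lemma Z2_val_inj (x y : Z2 F) : mgval (sgval x) = mgval (sgval y) -> x = y.
Proof. by move=> E; apply/val_inj/mg_inj. Qed.

End Z2Facts.

Section EvenDimension.
Variables (R : realType) (V : vectType R) (h : V -> R) (hq : quadratic_form h).
Variables (Cl : clifford_algebra h) (S : vectType R[i]) (g : rep Cl S).
Hypothesis S0 : (0 < \dim {:S})%N.
Local Notation gv v := (g (cl_in Cl v)).
Local Notation Pin := (Pin g).
Local Notation Spin := (Spin g).
Local Notation Lpin := (Lpin g).
Local Notation N := (gl_opp1 S).
Variables (e : (\dim {:V}).-tuple V) (eO : orthonormal_frame h e).
Hypothesis V0 : (0 < \dim {:V})%N.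
Variable T : GL S.
Hypothesis TT : (T * T = N)%g.
Hypothesis TV : forall v, (T \o gv v)%VF = - (gv v \o T)%VF.
Hypothesis scalar_comm : forall w : 'End(S),
  (forall v, (w \o gv v = gv v \o w)%VF) -> exists c, w = c *: \1%VF.
Hypothesis twist_Pin : exists l, exists2 q, sg_set Pin q & T = (gl_scalar S l * q)%g.
Local Notation even_gl := (even_gl T).
Local Notation odd_gl := (odd_gl T).
Implicit Types (a b p q : GL S).

Lemma even_lpin a : sg_set Lpin a -> exists l p,
  sg_set Pin p /\ a = (gl_scalar S l * twisted T p)%g.
Proof.
move=> /(lpin_decomp hq S0 eO TT TV)[d [p [Pp -> /centralV_comm/scalar_comm[c dc]]]].
have c0 : c != 0.
  by apply: contraNneq (glval_neq0 S0 d) => c0; rewrite dc c0 scale0r.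
exists (MulGrp c0), p; split=> //; congr (_ * _)%g.
by apply: gl_inj; rewrite dc.
Qed.

(** The commutant consists of scalars, so that A(h) is a line and its isometries
    are the two signs. *)
Lemma even_AhP w : w \in Ah g -> exists c, w = c *: glval T.
Proof.
move=> /(Ah_comm_twist TT TV)[d /scalar_comm[c ->] ->].
by exists c; rewrite -comp_lfunZl comp_lfun1l.
Qed.

Lemma h0_twist c : h0 (c *: glval T) = - c ^+ 2.
Proof.
apply: (h0E S0).
by rewrite -comp_lfunZl -comp_lfunZr twist_sq // scalerN scalerN scalerA scaleNr.
Qed.

Let r (f : Oh0 g) (x : Z2 R[i]) := act f T = mgval (sgval x) *: glval T.

Lemma even_theta_ex : exists theta : {multiplicative Oh0 g -> Z2 R[i]},
  bijective theta /\ forall f, r f (theta f).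
Proof.
have TA := twist_Ah TV.
have od1 : odd_gl (gl_of (gv (tnth e (Ordinal V0)))).
  by apply: odd_gl_vec => //; exact/unit_neq0/eO.1.
have L1 := vec_lpin g (unit_neq0 (eO.1 (Ordinal V0))).
apply: graph_isom => [f|x|f x y|f f' x|f f' x x']; rewrite /r.
- have [c fc] := even_AhP (act_in f T).
  have := h0_act f TA; rewrite fc -{2}[glval T]scale1r !h0_twist => /oppr_inj/eqP.
  rewrite expr1n sqrf_eq1 => /orP[]/eqP c1; first by exists 1%g; rewrite c1.
  by exists (Z2_opp1 _); rewrite c1.
- case: (Z2_cases x) => ->; first by exists 1%g; rewrite act1 // scale1r.
  exists (kappa g (sg_in L1)); rewrite act_kappa //.
  by rewrite [RHS]scaleN1r; apply/odd_gl_conj.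
- by move=> -> /(scaler_injr (glval_neq0 S0 T)); exact: Z2_val_inj.
- move=> fx f'x; apply: act_ext => w /even_AhP[c ->].
  by rewrite !actZ fx f'x.
- by move=> fx f'x'; rewrite actM f'x' actZ fx scalerA Z2_valM mulrC.
Qed.

Lemma Spin_even p : sg_set Spin p -> even_gl p.
Proof. by move/(mem_Spin S0 TV); case. Qed.

(** In the decomposition of [a], an odd [p] would make [a] anticommute with [T]. *)
Lemma even_kernel (a : Lpin) : even_gl (sgval a) <->
  exists l, exists2 p, sg_set Spin p & sgval a = (gl_scalar S l * p)%g.
Proof.
split=> [ae|[l [p /Spin_even pe ->]]]; last first.
  exact: even_glM (even_gl_scalar T l) pe.
have [l [p [Pp aE]]] := even_lpin (sgP a); exists l; exists p.
  apply/(mem_Spin S0 TV); split=> //.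
  have [//|po] := Pin_even_or_odd S0 TV Pp.
  have /(even_odd_absurd S0)[] := ae; rewrite aE twisted_odd //.
  exact: even_odd_glM (even_gl_scalar T l) (odd_even_glM po (even_gl_twist T)).
rewrite aE; congr (_ * _)%g; apply: twisted_even.
have [//|po] := Pin_even_or_odd S0 TV Pp.
have /(even_odd_absurd S0)[] := ae; rewrite aE twisted_odd //.
exact: even_odd_glM (even_gl_scalar T l) (odd_even_glM po (even_gl_twist T)).
Qed.

(** A unit vector, multiplied by the imaginary unit if its square is -1; it
    splits the sequence. *)
Lemma odd_involution : exists2 t : Lpin, (t * t = 1)%g & odd_gl (sgval t).
Proof.
pose v := tnth e (Ordinal V0).
have hv : h v = 1 \/ h v = -1 by exact: eO.1.
have [k kE] : exists k : mulgrp R[i], mgval k ^+ 2 * (h v)%:C%C = 1.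
  case: hv => ->; first by exists 1%g; rewrite expr1n mul1r.
  have i0 : 'i%C != 0 :> R[i] by rewrite complexiE neq0Ci.
  by exists (MulGrp i0); rewrite /= sqr_i rmorphN rmorph1 mulrNN mulr1.
have Lt := sgM (scalar_lpin g k) (vec_lpin g (unit_neq0 hv)).
exists (sg_in Lt).
  apply/val_inj/gl_inj; rewrite [LHS]glM gl_scalarE gl_of_vecE ?unit_neq0 //.
  by rewrite -comp_lfunZl -comp_lfunZr rep_vec_sq !scalerA -expr2 kE scale1r.
exact: even_odd_glM (even_gl_scalar T k) (odd_gl_vec TV (unit_neq0 hv)).
Qed.

Lemma even_dimension :
  (exists (theta : {multiplicative Oh0 g -> Z2 R[i]})
          (i : {multiplicative Cdot Spin -> Lpin}),
     [/\ bijective theta, Cdot_map i & split_exact_seq i (theta \o kappa g)]) /\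
  isomorphic Lpin (Cdot Pin).
Proof.
split; last first.
  apply: isomorphic_sym.
  have [j jI jE] := cdot_map_ex hq S0 eO TV (G := Pin) (fun p Pp => Pp).
  exists j; apply: inj_surj_bij => // a; apply/(cdot_image a jE).
  have [l [p [Pp ->]]] := even_lpin (sgP a).
  have [pe|po] := Pin_even_or_odd S0 TV Pp.
    by exists l; exists p; rewrite ?twisted_even.
  have [k [q Pq TE]] := twist_Pin.
  exists (l * k)%g; exists (p * q)%g; first exact: sgM.
  rewrite twisted_odd // {}TE [in RHS]gl_scalarM -!mulgA; congr (_ * _)%g.
  by rewrite !mulgA gl_scalarC.
have [theta [thB thE]] := even_theta_ex.
have [i iI iE] := cdot_map_ex hq S0 eO TV (G := Spin) (@Spin_Pin _ _ _ _ _ g).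
have TA := twist_Ah TV.
have thK (a : Lpin) x : gl_conj (sgval a) T = mgval (sgval x) *: glval T ->
    theta (kappa g a) = x.
  move=> ax; apply: Z2_val_inj; have := thE (kappa g a).
  by rewrite /r act_kappa // ax => /(scaler_injr (glval_neq0 S0 T)).
have thevn (a : Lpin) : theta (kappa g a) = 1%g <-> even_gl (sgval a).
  split=> [a1|/even_gl_conj ae]; last by apply: thK; rewrite scale1r.
  by apply/even_gl_conj; rewrite -act_kappa // thE a1 scale1r.
have thod (a : Lpin) : odd_gl (sgval a) -> theta (kappa g a) = Z2_opp1 _.
  by move/odd_gl_conj => ao; apply: thK; rewrite scaleN1r.
have [t tt to] := odd_involution.
exists theta, i; split=> //; split; last first.
  pose s (x : Z2 R[i]) : Lpin := if x == 1%g then 1%g else t.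
  have z1 : Z2_opp1 R[i] == 1%g = false.
    apply/eqP => /(congr1 (fun x => mgval (sgval x))) /eqP /=.
    by rewrite eqNr oner_eq0.
  have sM : {morph s : x y / (x * y)%g}.
    move=> x y; case: (Z2_cases x) => ->; case: (Z2_cases y) => ->;
      rewrite ?mul1g ?mulg1 /s ?Z2_opp1M ?eqxx ?z1 ?mul1g ?mulg1 //.
  exists (hom_of sM) => x /=; rewrite /s.
  case: (Z2_cases x) => ->; rewrite ?eqxx ?z1; last exact: thod.
  by apply/thevn; exact: even_gl1.
split=> [//|a|x].
  by rewrite (cdot_image a iE) -even_kernel; exact: thevn.
case: (Z2_cases x) => ->; [exists 1%g|exists t]; last exact: thod.
by apply/thevn; exact: even_gl1.
Qed.

End EvenDimension.

(** * The isometries of the hyperbolic plane *)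

Section SignedScalings.
Variable F : fieldType.
Local Notation D := (sdprod (phi F)).

(** The pairs [(1, t)] and [(-1, t)] run over the linear maps that preserve the
    form [b * c]: those that preserve its two isotropic lines and those that
    exchange them. *)
Definition sd_act (x : D) (u : F * F) : F * F :=
  if x.1 == 1%g then (mgval x.2 * u.1, (mgval x.2)^-1 * u.2)
  else (mgval x.2 * u.2, (mgval x.2)^-1 * u.1).

Hypothesis F2 : (-1 : F) != 1.

Lemma Z2_opp1_neq1 : (Z2_opp1 F == 1%g) = false.
Proof. by apply: contraNF F2 => /eqP/(congr1 (fun x => mgval (sgval x)))/eqP. Qed.

Lemma sd_actM x y u : sd_act (x * y)%g u = sd_act x (sd_act y u).
Proof.
case: x y u => [x t] [y s] [b c]; rewrite /sd_act /= /inv_fun.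
by case: (Z2_cases x) => ->; case: (Z2_cases y) => ->;
  rewrite ?mul1g ?mulg1 ?Z2_opp1M ?eqxx ?Z2_opp1_neq1 /= ?invfM ?invrK !mulrA.
Qed.

Lemma sd_act1 u : sd_act 1%g u = u.
Proof. by case: u => b c; rewrite /sd_act eqxx /= invr1 !mul1r. Qed.

Lemma sd_act_inj x y : sd_act x =1 sd_act y -> x = y.
Proof.
case: x y => [x t] [y s] E.
have := congr1 fst (E (1, 0)); have := congr1 fst (E (0, 1)).
rewrite /sd_act /=; case: (Z2_cases x) => ->; case: (Z2_cases y) => ->;
  rewrite ?eqxx ?Z2_opp1_neq1 /= ?mulr0 ?mulr1 => E2 E1.
- by rewrite (mg_inj E1).
- by have := mgP t; rewrite E1 eqxx.
- by have := mgP s; rewrite -E1 eqxx.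
- by rewrite (mg_inj E2).
Qed.

End SignedScalings.

(** * Odd dimension *)

Section OddDimension.
Variables (R : realType) (V : vectType R) (h : V -> R) (hq : quadratic_form h).
Variables (Cl : clifford_algebra h) (S : vectType R[i]) (g : rep Cl S).
Hypothesis S0 : (0 < \dim {:S})%N.
Local Notation gv v := (g (cl_in Cl v)).
Local Notation Pin := (Pin g).
Local Notation Spin := (Spin g).
Local Notation Lpin := (Lpin g).
Local Notation N := (gl_opp1 S).
Local Notation Cx := (mulgrp R[i]).
Local Notation D := (sdprod (phi R[i])).
Variables (e : (\dim {:V}).-tuple V) (eO : orthonormal_frame h e).
Variable T : GL S.
Hypothesis TT : (T * T = N)%g.
Hypothesis TV : forall v, (T \o gv v)%VF = - (gv v \o T)%VF.
Local Notation even_gl := (even_gl T).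
Local Notation odd_gl := (odd_gl T).
(** [E1] and [E2] are the projections onto the two summands of [S]. *)
Variables E1 E2 : 'End(S).
Hypothesis E12 : E1 + E2 = \1%VF.
Hypothesis E1E2 : (E1 \o E2)%VF = 0.
Hypothesis E2E1 : (E2 \o E1)%VF = 0.
Hypothesis TE1 : (T \o E1)%VF = (E2 \o T)%VF.
Hypothesis TE2 : (T \o E2)%VF = (E1 \o T)%VF.
Hypothesis E1V : forall v, (E1 \o gv v = gv v \o E1)%VF.
Hypothesis commE : forall w : 'End(S), (forall v, (w \o gv v = gv v \o w)%VF) ->
  exists b c, w = b *: E1 + c *: E2.
Hypothesis sign_Pin : exists l, exists2 q, sg_set Pin q &
  glval (gl_scalar S l * q)%g = E1 - E2.
Implicit Types (a p q : GL S).

(** The commutant of the vectors: [S] is a sum of two inequivalent irreducible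
    representations of the Clifford algebra. *)
Definition bidiag (u : R[i] * R[i]) : 'End(S) := u.1 *: E1 + u.2 *: E2.

Lemma E1E1 : (E1 \o E1)%VF = E1.
Proof. by rewrite -[RHS]comp_lfun1r -E12 comp_lfunDr E1E2 addr0. Qed.

Lemma E2E2 : (E2 \o E2)%VF = E2.
Proof. by rewrite -[RHS]comp_lfun1r -E12 comp_lfunDr E2E1 add0r. Qed.

Lemma E1_neq0 : E1 != 0.
Proof.
apply: contraNneq (lfun1_neq0 S0) => E10.
have : (E2 \o T)%VF = 0 by rewrite -TE1 E10 comp_lfun0r.
move/(congr1 (fun f => f \o T^-1)%VF); rewrite comp_lfun0l -comp_lfunA.
by rewrite lker0_compfV ?glP // comp_lfun1r -E12 E10 add0r => ->.
Qed.

Lemma E2_neq0 : E2 != 0.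
Proof.
apply: contraNneq (lfun1_neq0 S0) => E20.
have : (E1 \o T)%VF = 0 by rewrite -TE2 E20 comp_lfun0r.
move/(congr1 (fun f => f \o T^-1)%VF); rewrite comp_lfun0l -comp_lfunA.
by rewrite lker0_compfV ?glP // comp_lfun1r -E12 E20 addr0 => ->.
Qed.

Lemma bidiagM u v : (bidiag u \o bidiag v)%VF = bidiag (u.1 * v.1, u.2 * v.2).
Proof.
rewrite /bidiag !comp_lfunDl !comp_lfunDr -!comp_lfunZl -!comp_lfunZr.
by rewrite E1E1 E1E2 E2E1 E2E2 !scaler0 addr0 add0r !scalerA.
Qed.

Lemma bidiag_scalar c : bidiag (c, c) = c *: \1%VF.
Proof. by rewrite /bidiag -scalerDr E12. Qed.

(** [T] exchanges the two summands of [S]. *)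
Lemma twist_bidiag u : (T \o bidiag u)%VF = (bidiag (u.2, u.1) \o T)%VF.
Proof.
rewrite /bidiag comp_lfunDr comp_lfunDl -!comp_lfunZr -!comp_lfunZl TE1 TE2.
exact: addrC.
Qed.

Lemma E2V v : (E2 \o gv v = gv v \o E2)%VF.
Proof.
have -> : E2 = \1%VF - E1 by rewrite -E12 [E1 + E2]addrC addrK.
by rewrite comp_lfunDl comp_lfunDr comp_lfunNl comp_lfunNr comp_lfun1l comp_lfun1r E1V.
Qed.

Lemma bidiag_comm u v : (bidiag u \o gv v = gv v \o bidiag u)%VF.
Proof.
by rewrite /bidiag comp_lfunDr comp_lfunDl -!comp_lfunZr -!comp_lfunZl E1V E2V.
Qed.

Lemma bidiag_inj : injective bidiag.
Proof.
move=> u v uv.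
have E1uv : u.1 *: E1 = v.1 *: E1.
  have /(congr1 (fun f => f \o E1)%VF) := uv.
  by rewrite /bidiag !comp_lfunDl -!comp_lfunZl E1E1 E2E1 !scaler0 !addr0.
have E2uv : u.2 *: E2 = v.2 *: E2.
  have /(congr1 (fun f => f \o E2)%VF) := uv.
  by rewrite /bidiag !comp_lfunDl -!comp_lfunZl E2E2 E1E2 !scaler0 !add0r.
rewrite [u]surjective_pairing [v]surjective_pairing.
by rewrite (scaler_injr E1_neq0 E1uv) (scaler_injr E2_neq0 E2uv).
Qed.


Definition bidiag_gl (b c : Cx) : GL S := gl_of (bidiag (mgval b, mgval c)).

Lemma bidiag_glE b c : glval (bidiag_gl b c) = bidiag (mgval b, mgval c).
Proof.
apply: (@gl_ofE _ _ _ (bidiag ((mgval b)^-1, (mgval c)^-1))).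
by rewrite bidiagM /= !mulVf ?mgP // bidiag_scalar scale1r.
Qed.

Lemma bidiag_glM b c b' c' : (bidiag_gl b c * bidiag_gl b' c')%g = bidiag_gl (b * b')%g (c * c')%g.
Proof. by apply: gl_inj; rewrite glM !bidiag_glE !mg_valM bidiagM. Qed.

Lemma bidiag_gl_scalar c : bidiag_gl c c = gl_scalar S c.
Proof. by apply: gl_inj; rewrite bidiag_glE bidiag_scalar. Qed.

Lemma bidiag_gl1 : bidiag_gl 1%g 1%g = 1%g.
Proof. by rewrite bidiag_gl_scalar gl_scalar1. Qed.

Lemma bidiag_glV b c : (bidiag_gl b c)^-1%g = bidiag_gl b^-1%g c^-1%g.
Proof. by apply: (mulgI (bidiag_gl b c)); rewrite mulgV bidiag_glM !mulgV bidiag_gl1. Qed.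

Lemma bidiag_gl_inj b c b' c' : bidiag_gl b c = bidiag_gl b' c' -> b = b' /\ c = c'.
Proof.
move=> /(congr1 (@glval _ S)); rewrite !bidiag_glE => /bidiag_inj[bb cc].
by split; apply: mg_inj.
Qed.

Lemma twist_bidiag_gl b c : (T * bidiag_gl b c = bidiag_gl c b * T)%g.
Proof. by apply: gl_inj; rewrite !glM !bidiag_glE twist_bidiag. Qed.

Lemma Pin_bidiag_gl p b c : sg_set Pin p -> (p * bidiag_gl b c = bidiag_gl b c * p)%g.
Proof.
move=> /(Pin_parity S0 TV)[x px _]; apply: gl_inj.
by rewrite !glM bidiag_glE px (comm_rep (bidiag_comm _)).
Qed.

Lemma bidiag_gl_lpin b c : sg_set Lpin (bidiag_gl b c).
Proof. by apply/centralV_lpin/centralV_comm => v; rewrite bidiag_glE bidiag_comm. Qed.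

Lemma odd_lpin a : sg_set Lpin a -> exists b c p,
  sg_set Pin p /\ a = (bidiag_gl b c * twisted T p)%g.
Proof.
move=> /(lpin_decomp hq S0 eO TT TV)[d [p [Pp -> /centralV_comm/commE[b [c dbc]]]]].
have b0 : b != 0.
  apply: contraNneq E1_neq0 => b0.
  rewrite -[E1]comp_lfun1l -(lker0_compVf (glP d)) -comp_lfunA dbc b0 scale0r add0r.
  by rewrite -comp_lfunZl E2E1 scaler0 comp_lfun0r.
have c0 : c != 0.
  apply: contraNneq E2_neq0 => c0.
  rewrite -[E2]comp_lfun1l -(lker0_compVf (glP d)) -comp_lfunA dbc c0 scale0r addr0.
  by rewrite -comp_lfunZl E1E2 scaler0 comp_lfun0r.
exists (MulGrp b0), (MulGrp c0), p; split=> //; congr (_ * _)%g.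
by apply: gl_inj; rewrite bidiag_glE dbc.
Qed.

(** For odd [p] the product is not 1: [E1 - E2] commutes with the first factor
    and with [p], but anticommutes with [T].  For even [p], the first factor
    commutes with [T], which forces [b = c]. *)
Lemma bidiag_gl_twisted_eq1 b c p : sg_set Pin p ->
  (bidiag_gl b c * twisted T p)%g = 1%g -> [/\ even_gl p, b = c & (gl_scalar S b * p)%g = 1%g].
Proof.
move=> Pp; have [pe|po] := Pin_even_or_odd S0 TV Pp; last first.
  rewrite twisted_odd // => E; case: (@gl_opp1_neq1 _ _ S0).
  pose Z := bidiag_gl 1%g (mg_opp1 _).
  have TZ : (T * Z = N * Z * T)%g.
    rewrite twist_bidiag_gl; congr (_ * T)%g.
    by rewrite /gl_opp1 -bidiag_gl_scalar bidiag_glM mg_opp1M mulg1.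
  have ZE : (Z * (bidiag_gl b c * (p * T)) = N * (bidiag_gl b c * (p * T)) * Z)%g.
    have ZC : (Z * bidiag_gl b c = bidiag_gl b c * Z)%g by rewrite !bidiag_glM mul1g mulg1 mgC.
    have PZ : (p * Z = Z * p)%g by exact: Pin_bidiag_gl.
    rewrite [LHS]mulgA ZC -!mulgA [(Z * (p * T))%g]mulgA -PZ TZ -!mulgA.
    rewrite [(p * (N * _))%g]mulgA -gl_opp1C -mulgA.
    by rewrite [(_ * (N * _))%g]mulgA -gl_opp1C -mulgA gl_opp1K.
  by move: ZE; rewrite E !mulg1 => /esym; rewrite -{2}[Z]mul1g => /mulIg.
rewrite twisted_even // => E; have bc : b = c.
  have pE : p = bidiag_gl b^-1%g c^-1%g
    by rewrite -bidiag_glV; apply: (mulgI (bidiag_gl b c)); rewrite E mulgV.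
  have : (T * p = p * T)%g by exact: pe.
  by rewrite pE twist_bidiag_gl => /mulIg/bidiag_gl_inj[/invg_inj-> _].
by split=> //; rewrite -E -bc bidiag_gl_scalar.
Qed.


(** Coordinates on the plane A(h) in which [h0] is [- b * c]. *)
Definition antidiag (u : R[i] * R[i]) : 'End(S) := (bidiag u \o T)%VF.

Lemma antidiag_inj : injective antidiag.
Proof.
move=> u v /(congr1 (fun f => f \o T^-1)%VF).
by rewrite -!comp_lfunA lker0_compfV ?glP // !comp_lfun1r => /bidiag_inj.
Qed.

Lemma antidiag_Ah u : antidiag u \in Ah g.
Proof. by apply: comm_twist_Ah => // v; exact: bidiag_comm. Qed.

Lemma Ah_antidiag w : w \in Ah g -> exists u, w = antidiag u.
Proof.
move=> /(Ah_comm_twist TT TV)[d /commE[b [c ->]] ->].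
by exists (b, c).
Qed.

Lemma antidiagD u v : antidiag (u.1 + v.1, u.2 + v.2) = antidiag u + antidiag v.
Proof. by rewrite /antidiag /bidiag !scalerDl -comp_lfunDl addrACA. Qed.

Lemma antidiagZ k u : antidiag (k * u.1, k * u.2) = k *: antidiag u.
Proof. by rewrite /antidiag /bidiag -!scalerA -scalerDr -comp_lfunZl. Qed.

Lemma h0_antidiag u : h0 (antidiag u) = - (u.1 * u.2).
Proof.
apply: (h0E S0); rewrite /antidiag -comp_lfunA [(T \o (_ \o _))%VF]comp_lfunA twist_bidiag.
rewrite -comp_lfunA twist_sq // comp_lfunA bidiagM comp_lfunNr comp_lfun1r /=.
by rewrite [u.2 * _]mulrC bidiag_scalar scaleNr.
Qed.

Lemma complex_opp1_neq1 : (-1 : R[i]) != 1.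
Proof. by rewrite eqNr oner_eq0. Qed.

Definition conj_by a (x : D) := forall u, gl_conj a (antidiag u) = antidiag (sd_act x u).

Lemma conj_byM a (b : GL S) x y :
  conj_by a x -> conj_by b y -> conj_by (a * b)%g (x * y)%g.
Proof.
by move=> ax xb u; rewrite gl_conjM xb ax (sd_actM complex_opp1_neq1).
Qed.

Lemma conj_by_bidiag_gl b c : conj_by (bidiag_gl b c) (1%g, (b * c^-1)%g).
Proof.
move=> u; apply/gl_conjP; rewrite bidiag_glE /antidiag comp_lfunA bidiagM -comp_lfunA twist_bidiag.
rewrite comp_lfunA bidiagM /sd_act eqxx /=; congr (bidiag _ \o _)%VF.
congr pair; first by rewrite mulrAC divfK ?mgP.
by rewrite invfM invrK [RHS]mulrC !mulrA mulfV ?mgP ?mul1r.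
Qed.

Lemma conj_by_twist : conj_by T (Z2_opp1 _, 1%g).
Proof.
move=> u; apply/gl_conjP; rewrite /antidiag comp_lfunA twist_bidiag /sd_act /=.
by rewrite (Z2_opp1_neq1 complex_opp1_neq1) invr1 !mul1r.
Qed.

Lemma conj_by_even p : sg_set Pin p -> even_gl p -> conj_by p 1%g.
Proof.
move=> Pp /even_glP pe u; have [x px _] := Pin_parity S0 TV Pp.
apply/gl_conjP; rewrite sd_act1 /antidiag comp_lfunA px -(comm_rep (bidiag_comm u)) -px.
by rewrite -!comp_lfunA pe.
Qed.

Lemma conj_by_odd p : sg_set Pin p -> odd_gl p -> conj_by p (1%g, mg_opp1 _).
Proof.
move=> Pp /odd_glP po u; have [x px _] := Pin_parity S0 TV Pp.
have -> : antidiag (sd_act (1%g, mg_opp1 R[i]) u) = - antidiag u.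
  by rewrite /sd_act eqxx /= invrN invr1 antidiagZ scaleN1r.
apply/gl_conjP; rewrite comp_lfunNl /antidiag comp_lfunA px -(comm_rep (bidiag_comm u)) -px.
by rewrite -!comp_lfunA po comp_lfunNr opprK.
Qed.

Lemma conj_by_twisted_even b c p : sg_set Pin p -> even_gl p ->
  conj_by (bidiag_gl b c * twisted T p)%g (1%g, (b * c^-1)%g).
Proof.
move=> Pp pe; rewrite twisted_even // -[(1%g, _)](mulg1 (_ : D)).
exact: (conj_byM (conj_by_bidiag_gl b c) (conj_by_even Pp pe)).
Qed.

Lemma conj_by_twisted_odd b c p : sg_set Pin p -> odd_gl p -> exists2 x : D,
  x.1 = Z2_opp1 _ & conj_by (bidiag_gl b c * twisted T p)%g x.
Proof.
move=> Pp po; rewrite twisted_odd //.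
have := conj_byM (conj_by_bidiag_gl b c) (conj_byM (conj_by_odd Pp po) conj_by_twist).
by move=> H; eexists; last exact: H; rewrite /= !mul1g.
Qed.

Let r (f : Oh0 g) (x : D) := forall u, act f (antidiag u) = antidiag (sd_act x u).

Lemma conj_by_kappa (a : Lpin) x : conj_by (sgval a) x -> r (kappa g a) x.
Proof. by move=> ax u; rewrite act_kappa ?antidiag_Ah // ax. Qed.

Lemma odd_isometry_lift (x : D) : exists a : Lpin, conj_by (sgval a) x.
Proof.
have Lt (t : Cx) : conj_by (bidiag_gl t 1%g) (1%g, t).
  by have := conj_by_bidiag_gl t 1%g; rewrite invg1 mulg1.
case: x => [y t]; case: (Z2_cases y) => ->.
  by exists (sg_in (bidiag_gl_lpin t 1%g)); exact: Lt.
exists (sg_in (sgM (bidiag_gl_lpin t 1%g) (twist_lpin TT TV))).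
have -> : ((Z2_opp1 R[i], t) : D) = (((1, t) : D) * (Z2_opp1 _, 1))%g.
  by congr pair; rewrite ?mul1g //= inv_fun1 mulg1.
exact: (conj_byM (Lt t) conj_by_twist).
Qed.

Lemma odd_isometry_functional f x y : r f x -> r f y -> x = y.
Proof.
move=> fx fy; apply: (sd_act_inj complex_opp1_neq1) => u.
by apply: antidiag_inj; rewrite -fx fy.
Qed.

(** The images of [antidiag (1, 0)] and [antidiag (0, 1)] are isotropic, so that
    each has a zero coordinate; the value of [h0] on the image of
    [antidiag (1, 1)] makes the other two coordinates inverse to each other. *)
Lemma odd_isometry_total f : exists x, r f x.
Proof.
have [[p q] f10] := Ah_antidiag (act_in f (antidiag (1, 0))).
have [[k s] f01] := Ah_antidiag (act_in f (antidiag (0, 1))).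
have fE b c : act f (antidiag (b, c)) = antidiag (b * p + c * k, b * q + c * s).
  have -> : antidiag (b, c) = b *: antidiag (1, 0) + antidiag (c * 0, c * 1).
    by rewrite -antidiagZ -antidiagD /= !mulr0 !mulr1 addr0 add0r.
  by rewrite act_linear (antidiagZ c (0, 1)) actZ f10 f01 -!antidiagZ -antidiagD.
have hE b c : (b * p + c * k) * (b * q + c * s) = b * c.
  by have := h0_act f (antidiag_Ah (b, c)); rewrite fE !h0_antidiag => /oppr_inj.
have := hE 1 0; rewrite !mul1r !mul0r !addr0 => pq.
have := hE 0 1; rewrite !mul1r !mul0r !add0r => ks.
have := hE 1 1; rewrite !mul1r => h11.
have [q0|q0] := eqVneq q 0.
  have ps : p * s = 1 by rewrite -h11 q0 add0r mulrDl ks addr0.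
  have p0 : p != 0 by apply: contra_eq_neq ps => ->; rewrite mul0r eq_sym oner_eq0.
  have s0 : s != 0 by apply: contra_eq_neq ps => ->; rewrite mulr0 eq_sym oner_eq0.
  have k0 : k = 0 by move/eqP: ks; rewrite mulf_eq0 (negPf s0) orbF => /eqP.
  have sE : s = p^-1 by apply: (mulfI p0); rewrite ps mulfV.
  exists (1%g, MulGrp p0) => -[b c]; rewrite fE /sd_act eqxx /=.
  by rewrite k0 q0 sE !mulr0 addr0 add0r mulrC [c * _]mulrC.
have p0 : p = 0 by move/eqP: pq; rewrite mulf_eq0 (negPf q0) orbF => /eqP.
have kq : k * q = 1 by rewrite -h11 p0 add0r mulrDr ks addr0.
have k0 : k != 0 by apply: contra_eq_neq kq => ->; rewrite mul0r eq_sym oner_eq0.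
have s0 : s = 0 by move/eqP: ks; rewrite mulf_eq0 (negPf k0) => /eqP.
have qE : q = k^-1 by apply: (mulfI k0); rewrite kq mulfV.
exists (Z2_opp1 _, MulGrp k0) => -[b c].
rewrite fE /sd_act (Z2_opp1_neq1 complex_opp1_neq1) /=.
by rewrite p0 s0 qE !mulr0 addr0 add0r mulrC [b * _]mulrC.
Qed.

Lemma odd_theta_ex : exists theta : {multiplicative Oh0 g -> D},
  bijective theta /\ forall f, r f (theta f).
Proof.
apply: graph_isom => [f|x|f x y|f f' x fx f'x|f f' x x' fx fx' u].
- exact: odd_isometry_total.
- by have [a ax] := odd_isometry_lift x; exists (kappa g a); exact: conj_by_kappa.
- exact: odd_isometry_functional.
- by apply: act_ext => w /Ah_antidiag[u ->]; rewrite fx f'x.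
- by rewrite actM fx' fx (sd_actM complex_opp1_neq1).
Qed.

(** The two cases are the two components of the orthogonal group of the plane
    A(h), according to the parity of [p]. *)
Lemma odd_lpin_cases (a : Lpin) :
  (exists b c p, [/\ sg_set Pin p, even_gl p, sgval a = (bidiag_gl b c * p)%g &
    conj_by (sgval a) (1%g, (b * c^-1)%g)]) \/
  (exists2 x : D, x.1 = Z2_opp1 _ & conj_by (sgval a) x).
Proof.
have [b [c [p [Pp aE]]]] := odd_lpin (sgP a); rewrite aE.
have [pe|po] := Pin_even_or_odd S0 TV Pp; last first.
  by right; exact: conj_by_twisted_odd.
left; exists b, c, p; split; rewrite ?twisted_even //.
by rewrite -{1}(twisted_even pe); exact: conj_by_twisted_even.
Qed.

Lemma conj_by_scalar l : conj_by (gl_scalar S l) 1%g.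
Proof. by move=> u; rewrite gl_conj_scalar sd_act1. Qed.

(** Odd elements of the Pin group act on A(h) by -1, so that the second sequence
    is about the kernel of [kappa] modulo sign.  That kernel also contains the
    multiples of [E1 - E2], which are in the product of the scalars with the
    Pin group because the volume element is. *)
Lemma odd_kappa_sequences : exists (theta : {multiplicative Oh0 g -> D})
    (i : {multiplicative Cdot Spin -> Lpin})
    (j : {multiplicative Cdot Pin -> Lpin}),
  [/\ bijective theta, Cdot_map i, exact_seq i (theta \o kappa g),
      Cdot_map j & exact_seq j (@sd_square R[i] \o (theta \o kappa g))].
Proof.
have [theta [thB thE]] := odd_theta_ex.
have thK (a : Lpin) x : conj_by (sgval a) x -> theta (kappa g a) = x.
  by move/conj_by_kappa; exact: odd_isometry_functional.
have [i iI iE] := cdot_map_ex hq S0 eO TV (G := Spin) (@Spin_Pin _ _ _ _ _ g).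
have [j jI jE] := cdot_map_ex hq S0 eO TV (G := Pin) (fun p Pp => Pp).
have thS x : exists a : Lpin, theta (kappa g a) = x.
  by have [a /thK] := odd_isometry_lift x; exists a.
have nz (x : D) : x.1 = Z2_opp1 _ -> x.1 <> 1%g.
  by move=> -> /eqP; rewrite (Z2_opp1_neq1 complex_opp1_neq1).
have ker1 (a : Lpin) : theta (kappa g a) = 1%g <-> exists l,
    exists2 p, sg_set Spin p & sgval a = (gl_scalar S l * p)%g.
  split=> [a1|[l [p Sp aE]]]; last first.
    apply: thK; rewrite aE -[1%g]mulg1.
    have [Pp pe] := (mem_Spin S0 TV p).1 Sp.
    exact: (conj_byM (conj_by_scalar l) (conj_by_even Pp pe)).
  have [[b [c [p [Pp pe aE /thK]]]]|[x /nz x1 /thK]] := odd_lpin_cases a; last first.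
    by rewrite a1 => /(congr1 fst)/esym.
  rewrite a1 => /(congr1 (fun x : D => x.2))/= bc1.
  have bc : b = c by rewrite -[b](mulgVK c) -bc1 mul1g.
  exists c; exists p; first exact/(mem_Spin S0 TV).
  by rewrite aE bc bidiag_gl_scalar.
have ker2 (a : Lpin) : sd_square (theta (kappa g a)) = 1%g <-> exists l,
    exists2 p, sg_set Pin p & sgval a = (gl_scalar S l * p)%g.
  split=> [a1|[l [p Pp aE]]]; last first.
    have [pe|po] := Pin_even_or_odd S0 TV Pp.
      have -> : theta (kappa g a) = 1%g.
        apply: thK; rewrite aE -[1%g]mulg1.
        exact: (conj_byM (conj_by_scalar l) (conj_by_even Pp pe)).
      by congr pair; rewrite mulg1.
    have -> : theta (kappa g a) = (1%g, mg_opp1 _).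
      apply: thK; rewrite aE -[(1%g, _)](mul1g (_ : D)).
      exact: (conj_byM (conj_by_scalar l) (conj_by_odd Pp po)).
    by congr pair; exact: mg_opp1M.
  have [[b [c [p [Pp pe aE /thK]]]]|[x /nz x1 /thK xE]] := odd_lpin_cases a; last first.
    by move: a1; rewrite xE => /(congr1 fst).
  move=> E; move: a1; rewrite E => /(congr1 (fun x : D => mgval x.2)) /=.
  rewrite -expr2 => /eqP; rewrite sqrf_eq1 => /orP[]/eqP bc.
    have {}bc : b = c.
      by apply: mg_inj; rewrite -[LHS](divfK (mgP c)) bc mul1r.
    by exists c; exists p; rewrite // aE bc bidiag_gl_scalar.
  (* Here b = - c, and the first factor is a multiple of E1 - E2. *)
  have [l [q Pq qE]] := sign_Pin.
  exists (b * l)%g; exists (q * p)%g; first exact: (sgM Pq Pp).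
  rewrite aE gl_scalarM -mulgA [(gl_scalar S l * _)%g]mulgA [RHS]mulgA.
  congr (_ * _)%g; apply: gl_inj; rewrite gl_scalarE qE bidiag_glE /bidiag /=.
  have cE : mgval c = - mgval b.
    by rewrite -[mgval b](divfK (mgP c)) bc mulN1r opprK.
  by rewrite scalerBr cE scaleNr.
exists theta, i, j; split=> //; split=> [//|a|x].
- by rewrite (cdot_image a iE); exact: ker1.
- exact: thS.
- by rewrite (cdot_image a jE); exact: ker2.
- have [t tE] : exists t : Cx, (t * t)%g = x.2.
    have t0 : sqrtC (mgval x.2) != 0 by rewrite sqrtC_eq0 mgP.
    by exists (MulGrp t0); apply: mg_inj; rewrite mg_valM -expr2 sqrtCK.
  have [a aE] := thS (x.1, t); exists a.
  apply: (etrans (congr1 (@sd_square R[i]) aE)).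
  by rewrite /sd_square /= tE -surjective_pairing.
Qed.


Definition spin_swap (a : Pin) (n : Cx * Cx) : Cx * Cx :=
  if `[< sg_set Spin (sgval a) >] then n else (n.2, n.1).

Lemma spin_swap_even (a : Pin) n : even_gl (sgval a) -> spin_swap a n = n.
Proof.
by move=> ae; rewrite /spin_swap asboolT //; apply/(mem_Spin S0 TV); split=> //; exact: sgP.
Qed.

Lemma spin_swap_odd (a : Pin) n : odd_gl (sgval a) -> spin_swap a n = (n.2, n.1).
Proof.
move=> ao; rewrite /spin_swap asboolF // => /(mem_Spin S0 TV)[_ ae].
exact: (even_odd_absurd S0 ae ao).
Qed.

Lemma spin_swap1 n : spin_swap 1%g n = n.
Proof. by apply: spin_swap_even; exact: even_gl1. Qed.

Lemma spin_swapM (a b : Pin) n : spin_swap (a * b)%g n = spin_swap a (spin_swap b n).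
Proof.
have [ae|ao] := Pin_even_or_odd S0 TV (sgP a); have [be|bo] := Pin_even_or_odd S0 TV (sgP b).
- by rewrite !spin_swap_even //; exact: even_glM.
- by rewrite (spin_swap_even _ ae) !spin_swap_odd //; exact: even_odd_glM.
- by rewrite (spin_swap_even _ be) !spin_swap_odd //; exact: odd_even_glM.
- rewrite spin_swap_even ?(spin_swap_odd _ ao) ?(spin_swap_odd _ bo) /=.
    by case: n.
  exact: odd_glM.
Qed.

Lemma spin_swap_mul (a : Pin) n n' :
  spin_swap a (n * n')%g = (spin_swap a n * spin_swap a n')%g.
Proof. by rewrite /spin_swap; case: ifP. Qed.

Definition swap_aut : autaction Pin (Cx * Cx)%type :=
  AutAction spin_swap1 spin_swapM spin_swap_mul.

(** An odd element contributes a factor [T], which exchanges the two summands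
    of [S]. *)
Lemma twisted_bidiag_gl (a : Pin) n :
  (twisted T (sgval a) * bidiag_gl n.1 n.2 =
   bidiag_gl (spin_swap a n).1 (spin_swap a n).2 * twisted T (sgval a))%g.
Proof.
have [ae|ao] := Pin_even_or_odd S0 TV (sgP a).
  by rewrite spin_swap_even // twisted_even // Pin_bidiag_gl //; exact: sgP.
rewrite spin_swap_odd // twisted_odd // -mulgA twist_bidiag_gl mulgA Pin_bidiag_gl ?mulgA //.
exact: sgP.
Qed.

Definition sdprod_lpin (x : sdprod swap_aut) : Lpin :=
  sg_in (sgM (bidiag_gl_lpin x.2.1 x.2.2) (twisted_lpin S0 TT TV (sgP x.1))).

Lemma sdprod_lpinE x :
  sgval (sdprod_lpin x) = (bidiag_gl x.2.1 x.2.2 * twisted T (sgval x.1))%g.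
Proof. by []. Qed.

Lemma sdprod_lpinM : {morph sdprod_lpin : x y / (x * y)%g}.
Proof.
move=> [a n] [b k]; apply: val_inj.
rewrite [RHS]/= [LHS]sdprod_lpinE /= (twistedM S0 TT TV (sgP a) (sgP b)).
rewrite -bidiag_glM -!mulgA; congr (_ * _)%g.
by rewrite !mulgA twisted_bidiag_gl.
Qed.

(** The normal factor is the commutant, on which the Pin group acts through
    [twisted]. *)
Lemma odd_semidirect : exists2 psi : autaction Pin (Cx * Cx)%type,
  swap_action psi & isomorphic (Pin_sdprod_quo psi) Lpin.
Proof.
exists swap_aut => [a aS l k|].
  have [ae|ao] := Pin_even_or_odd S0 TV (sgP a); last exact: spin_swap_odd.
  by case: aS; apply/(mem_Spin S0 TV); split=> //; exact: sgP.
have [x [p1 [l1 k1]]|[a [l k]] E|f [fI fE]] := @quo_lift _ _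
  [set x : sdprod swap_aut | glval (sgval x.1) = - \1%VF /\
    mgval x.2.1 = -1 /\ mgval x.2.2 = -1]%classic (hom_of sdprod_lpinM).
- apply: val_inj; rewrite [LHS]sdprod_lpinE.
  have -> : sgval x.1 = N by apply: gl_inj; rewrite p1 gl_opp1_val.
  have -> : x.2.1 = mg_opp1 _ by apply: mg_inj.
  have -> : x.2.2 = mg_opp1 _ by apply: mg_inj.
  rewrite twisted_even; last exact: even_gl_scalar.
  by rewrite bidiag_gl_scalar gl_opp1M.
- have {E} : sgval (sdprod_lpin (a, (l, k))) = 1%g.
    by rewrite -[sdprod_lpin _]/(hom_of sdprod_lpinM (a, (l, k))) E.
  rewrite sdprod_lpinE => /(bidiag_gl_twisted_eq1 (sgP a))[_ /= <- la].
  have aE : glval (sgval a) = (mgval l)^-1 *: \1%VF.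
    have /(congr1 (@glval _ S)) := la; rewrite gl_scalarE => E.
    by rewrite -[\1%VF]E scalerA mulVf ?mgP // scale1r.
  have [l1|l1] := Pin_scalar hq S0 eO TV (sgP a) aE.
    left; have -> : l = 1%g by apply: mg_inj; rewrite /= -[LHS]invrK l1 invr1.
    by congr pair; apply/val_inj/gl_inj; rewrite [LHS]aE l1 scale1r.
  have lN : mgval l = -1 by rewrite -[LHS]invrK l1 invrN invr1.
  by right; split; rewrite //= aE l1 scaleN1r.
exists f; apply: inj_surj_bij => // a.
have [b [c [p [Pp aE]]]] := odd_lpin (sgP a).
exists (toquo _ ((sg_in Pp, (b, c)) : sdprod swap_aut)).
rewrite fE; apply: val_inj.
suff : sgval (sdprod_lpin (sg_in Pp, (b, c))) = sgval a by [].
by rewrite sdprod_lpinE aE.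
Qed.

End OddDimension.

(** * The volume element *)

Section Volume.
Variables (R : realType) (V : vectType R) (h : V -> R) (hq : quadratic_form h).
Variables (Cl : clifford_algebra h).
Variables (e : (\dim {:V}).-tuple V) (eO : orthonormal_frame h e).
Local Notation m := (\dim {:V}).

Lemma volume_word : volume Cl e = word Cl e (enum 'I_m).
Proof. by rewrite /word enumT. Qed.

(** Each letter but one of the volume element contributes a sign. *)
Lemma volume_comm v :
  cl_in Cl v * volume Cl e = (-1) ^+ m.+1 * (volume Cl e * cl_in Cl v).
Proof.
have [k ->] := frame_expand hq eO v.
rewrite linear_sum mulr_suml !mulr_sumr; apply: eq_bigr => i _.
rewrite linearZ -scalerAl -!scalerAr volume_word (word_comm Cl eO).
by rewrite size_enum_ord count_uniq_mem ?enum_uniq // mem_enum addn1.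
Qed.

Lemma grading_volume : grading Cl (volume Cl e) = (-1) ^+ m * volume Cl e.
Proof. by rewrite volume_word grading_word size_enum_ord. Qed.

Lemma volume_sq : volume Cl e * volume Cl e = 1 \/ volume Cl e * volume Cl e = -1.
Proof. by rewrite volume_word; exact: word_sq. Qed.

Variables (S : vectType R[i]) (g : rep Cl S).

Lemma Pin_word s : exists2 q, sg_set (Pin g) q & glval q = g (word Cl e s).
Proof.
elim: s => [|i s [q Pq qE]].
  by exists 1%g; [exact: sg1 | rewrite /word big_nil rep1].
exists (gl_of (g (cl_in Cl (tnth e i))) * q)%g.
  exact: (sgM (gl_of_vec_Pin (eO.1 i)) Pq).
by rewrite glM gl_of_vecE ?(unit_neq0 (eO.1 i)) // qE /word big_cons repM.
Qed.

Lemma Pin_volume : exists2 q, sg_set (Pin g) q & glval q = g (volume Cl e).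
Proof. by rewrite volume_word; exact: Pin_word. Qed.

End Volume.

(** * The structure of the Dirac representation *)

Section Dirac.
Variables (R : realType) (V : vectType R) (h : V -> R).
Hypothesis hq : quadratic_form h.
Variables (Cl : clifford_algebra h) (S : vectType R[i]) (g : rep Cl S).
Local Notation gv v := (g (cl_in Cl v)).
Variables (e : (\dim {:V}).-tuple V) (eO : orthonormal_frame h e).

(** The volume element anticommutes with vectors in even dimension, and its square
    is 1 or -1; a scalar factor makes it -1. *)
Lemma even_twist_ex : ~~ odd (\dim {:V}) -> exists T : GL S,
  [/\ (T * T)%g = gl_opp1 S, forall v, (T \o gv v)%VF = - (gv v \o T)%VF &
      exists l, exists2 q, sg_set (Pin g) q & T = (gl_scalar S l * q)%g].
Proof.
move=> Veven; have [q Pq qE] := Pin_volume eO g.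
have [k kE] : exists k : mulgrp R[i],
    mgval k ^+ 2 *: g (volume Cl e * volume Cl e) = - \1%VF.
  case: (volume_sq Cl eO) => ->; last first.
    by exists 1%g; rewrite expr1n scale1r repN rep1.
  have i0 : 'i%C != 0 :> R[i] by rewrite complexiE neq0Ci.
  by exists (MulGrp i0); rewrite /= sqr_i scaleN1r rep1.
exists (gl_scalar S k * q)%g; split; last by exists k, q.
  apply: gl_inj; rewrite glM gl_scalarE -comp_lfunZl -comp_lfunZr scalerA.
  by rewrite -expr2 qE -repM kE gl_opp1_val.
move=> v; rewrite gl_scalarE -comp_lfunZl -comp_lfunZr -scalerN qE; congr (_ *: _).
rewrite -!repM (volume_comm hq Cl eO) -signr_odd /= Veven expr1 mulN1r repN opprK.
by [].
Qed.

End Dirac.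

(** * The structure of the Cartan representation *)

Section Cartan.
Variables (R : realType) (V : vectType R) (h : V -> R).
Hypothesis hq : quadratic_form h.
Variables (Cl : clifford_algebra h) (S : vectType R[i]) (g : rep Cl S).
Local Notation gv v := (g (cl_in Cl v)).
Variables (e : (\dim {:V}).-tuple V) (eO : orthonormal_frame h e).
Hypothesis Vodd : odd (\dim {:V}).
Variables (P : vectType R[i]) (s : rep Cl P).
Hypothesis s_irr : irreducible_on s (Cl_even Cl).
Hypothesis s_vol : s (volume Cl e) = iota_h Cl e *: \1%VF.
Variables (j : {linear (P * P)%type -> S}) (j' : S -> (P * P)%type).
Hypotheses (jK : cancel j j') (j'K : cancel j' j).
Hypothesis gj : forall x u v, g x (j (u, v)) = j (s x u, s (grading Cl x) v).

Lemma j'_linear : linear j'.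
Proof. by move=> a x y; apply: (can_inj jK); rewrite linearP !j'K. Qed.

Lemma cartan_dim : (0 < \dim {:S})%N.
Proof.
have [P0 _] := s_irr; rewrite lt0n dimv_eq0; apply/negP => /eqP S0.
have : (fullv : {vspace P}) == 0%VS.
  rewrite -subv0; apply/subvP => u _; rewrite memv0.
  have : j (u, 0) \in (fullv : {vspace S}) by exact: memvf.
  rewrite S0 memv0 -(linear0 j) (inj_eq (can_inj jK)).
  by move=> /eqP/(congr1 fst) /= ->.
by rewrite -dimv_eq0 => /eqP E; rewrite E in P0.
Qed.

Lemma cartan_lfunP (f1 f2 : 'End(S)) :
  (forall u v, f1 (j (u, v)) = f2 (j (u, v))) -> f1 = f2.
Proof. by move=> f12; apply/lfunP => x; rewrite -(j'K x); case: (j' x). Qed.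

(** Endomorphisms of [S] are given through those of [P * P], so that equalities
    can be checked on pairs. *)
Lemma block_ex (f : P * P -> P * P) : linear f ->
  exists F : 'End(S), forall u, F (j u) = j (f u).
Proof.
move=> f_lin; have F_lin : linear (fun x => j (f (j' x))).
  by move=> a x y; rewrite j'_linear f_lin linearP.
pose F : {linear S -> S} :=
  HB.pack (fun x => j (f (j' x))) (GRing.isLinear.Build _ S S _ _ F_lin).
by exists (linfun F) => u; rewrite lfunE /= jK.
Qed.

(** The grading changes the sign of the volume element in odd dimension, so that
    it acts by [iota] on the first summand and by [- iota] on the second.  Hence
    [E1 - E2] is a multiple of it, and an endomorphism commuting with vectors
    preserves both summands; each is irreducible under the even subalgebra,
    and Schur's lemma applies to each.  The exchange of the summands, up to
    a factor, is [T]. *)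
Lemma cartan_structure : exists T : GL S,
  [/\ (T * T)%g = gl_opp1 S, forall v, (T \o gv v)%VF = - (gv v \o T)%VF &
   exists E1 E2 : 'End(S),
    [/\ E1 + E2 = \1%VF, (E1 \o E2)%VF = 0, (E2 \o E1)%VF = 0,
        (T \o E1)%VF = (E2 \o T)%VF & (T \o E2)%VF = (E1 \o T)%VF] /\
    [/\ forall v, (E1 \o gv v = gv v \o E1)%VF,
        forall w : 'End(S), (forall v, (w \o gv v = gv v \o w)%VF) ->
          exists b c, w = b *: E1 + c *: E2 &
        exists l, exists2 q, sg_set (Pin g) q &
          glval (gl_scalar S l * q)%g = E1 - E2]].
Proof.
have jD u v : j u + j v = j (u + v) by rewrite linearD.
have jZ k u : k *: j u = j (k *: u) by rewrite linearZ.
have jN u : - j u = j (- u) by rewrite linearN.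
have [E1 E1E] := @block_ex (fun u => (u.1, 0))
  ltac:(by move=> a [x y] [z t]; congr pair; rewrite /= scaler0 addr0).
have [E2 E2E] := @block_ex (fun u => (0, u.2))
  ltac:(by move=> a [x y] [z t]; congr pair; rewrite /= scaler0 addr0).
have [T0 T0E] := @block_ex (fun u => ('i%C *: u.2, 'i%C *: u.1))
  ltac:(by move=> a [x y] [z t]; congr pair; rewrite /= scalerDr !scalerA mulrC).
have TT0 : (T0 \o T0)%VF = - \1%VF.
  apply: cartan_lfunP => u v; rewrite !lfun_simp !T0E /= jN !scalerA -expr2 sqr_i.
  by rewrite !scaleN1r.
have TE : glval (gl_of T0) = T0.
  by apply: (@gl_ofE _ _ _ (- T0)); rewrite comp_lfunNl TT0 opprK.
exists (gl_of T0); rewrite TE.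
pose k := iota_h Cl e.
have k0 : k != 0.
  rewrite /k /iota_h; case: ifP => _; first exact: oner_neq0.
  by rewrite complexiE neq0Ci.
have gvol u v : g (volume Cl e) (j (u, v)) = k *: j (u, - v).
  rewrite gj grading_volume -signr_odd Vodd expr1 mulN1r repN s_vol !lfun_simp.
  by rewrite jZ; congr (j (_, _)); rewrite scalerN.
have gvE v u w : gv v (j (u, w)) = j (s (cl_in Cl v) u, - s (cl_in Cl v) w).
  by rewrite gj grading_in repN !lfun_simp.
have EE : E1 - E2 = k^-1 *: g (volume Cl e).
  apply: cartan_lfunP => u v; rewrite !lfun_simp E1E E2E gvol scalerA mulVf //.
  by rewrite scale1r jN jD; congr (j (_, _)); rewrite /= ?oppr0 ?addr0 ?add0r.
have E12 : E1 + E2 = \1%VF.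
  apply: cartan_lfunP => u v; rewrite !lfun_simp E1E E2E jD.
  by congr (j (_, _)); rewrite /= ?addr0 ?add0r.
split=> [|v|].
- by apply: gl_inj; rewrite glM TE TT0 gl_opp1_val.
- apply: cartan_lfunP => u w; rewrite !lfun_simp gvE !T0E gvE jN.
  by congr (j _); congr pair; rewrite /= linearZ ?opprK ?scalerN.
exists E1, E2; split; split=> //.
- by apply: cartan_lfunP => u w; rewrite !lfun_simp E2E E1E /= linear0.
- by apply: cartan_lfunP => u w; rewrite !lfun_simp E1E E2E /= linear0.
- by apply: cartan_lfunP => u w; rewrite !lfun_simp E1E !T0E E2E /= scaler0.
- by apply: cartan_lfunP => u w; rewrite !lfun_simp E2E !T0E E1E /= scaler0.
- move=> v; apply: cartan_lfunP => u w; rewrite !lfun_simp gvE !E1E gvE /=.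
  by rewrite linear0 oppr0.
- move=> w wV; have wg := comm_rep wV.
  have wD : (w \o (E1 - E2) = (E1 - E2) \o w)%VF.
    by rewrite EE -comp_lfunZr -comp_lfunZl wg.
  have two0 : (2 : R[i]) != 0 by rewrite pnatr_eq0.
  have E1D : E1 = 2^-1 *: (\1%VF + (E1 - E2)).
    rewrite -E12 addrACA subrr addr0 -mulr2n -[E1 *+ 2]scaler_nat scalerA mulVf //.
    by rewrite scale1r.
  have wE1 : (w \o E1 = E1 \o w)%VF.
    rewrite E1D -comp_lfunZr -comp_lfunZl comp_lfunDr comp_lfunDl wD.
    by rewrite comp_lfun1l comp_lfun1r.
  have wE2 : (w \o E2 = E2 \o w)%VF.
    have -> : E2 = \1%VF - E1 by rewrite -E12 [E1 + E2]addrC addrK.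
    rewrite comp_lfunDr comp_lfunDl comp_lfunNr comp_lfunNl wE1.
    by rewrite comp_lfun1l comp_lfun1r.
  have w1_lin : linear (fun u => (j' (w (j (u, 0)))).1).
    move=> a u v; have -> : (a *: u + v, 0) = a *: (u, 0) + (v, 0) :> P * P.
      by congr pair; rewrite /= scaler0 addr0.
    by rewrite !linearP j'_linear.
  have w2_lin : linear (fun u => (j' (w (j (0, u)))).2).
    move=> a u v; have -> : (0, a *: u + v) = a *: (0, u) + (0, v) :> P * P.
      by congr pair; rewrite /= scaler0 addr0.
    by rewrite !linearP j'_linear.
  pose w1 : 'End(P) := linfun (HB.pack (fun u => (j' (w (j (u, 0)))).1)
    (GRing.isLinear.Build _ P P _ _ w1_lin) : {linear P -> P}).
  pose w2 : 'End(P) := linfun (HB.pack (fun u => (j' (w (j (0, u)))).2)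
    (GRing.isLinear.Build _ P P _ _ w2_lin) : {linear P -> P}).
  have w1E u : w (j (u, 0)) = j (w1 u, 0).
    have : w (E1 (j (u, 0))) = E1 (w (j (u, 0))) by rewrite -!comp_lfunE wE1.
    by rewrite E1E /= -{2}[w _]j'K E1E /w1 lfunE /=.
  have w2E u : w (j (0, u)) = j (0, w2 u).
    have : w (E2 (j (0, u))) = E2 (w (j (0, u))) by rewrite -!comp_lfunE wE2.
    by rewrite E2E /= -{2}[w _]j'K E2E /w2 lfunE /=.
  have [|b w1b] := schur (w := w1) s_irr.
    move=> x ex; apply/lfunP => u; rewrite !comp_lfunE.
    have : w (g x (j (u, 0))) = g x (w (j (u, 0))) by rewrite -!comp_lfunE wg.
    by rewrite w1E !gj !linear0 w1E => /(can_inj jK)[].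
  have [|c w2c] := schur (w := w2) s_irr.
    move=> x ex; apply/lfunP => u; rewrite !comp_lfunE.
    have : w (g x (j (0, u))) = g x (w (j (0, u))) by rewrite -!comp_lfunE wg.
    by rewrite w2E !gj !linear0 w2E [grading Cl x]ex => /(can_inj jK)[].
  exists b, c; apply: cartan_lfunP => u v.
  have -> : (u, v) = (u, 0) + (0, v) by congr pair; rewrite /= ?addr0 ?add0r.
  rewrite !lfun_simp [j (_ + _)]linearD !linearD /= w1E w2E w1b w2c !E1E !E2E /=.
  rewrite !lfun_simp !linear0 addr0 add0r !jZ !jD.
  by congr (j (_, _)); rewrite /= ?scaler0 ?addr0 ?add0r.
- have [q Pq qE] := Pin_volume eO g.
  exists (MulGrp (invr_neq0 k0)), q => //.
  by rewrite gl_scalarE qE EE.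
Qed.

End Cartan.

(** * The Lipschitz group of a quadratic space *)

Theorem theorem1 (R : realType) (V : vectType R) (h : V -> R)
    (h_quad : quadratic_form h) (h_nondeg : nondegenerate_form h)
    (m_gt0 : (0 < \dim {:V})%N)
    (Cl : clifford_algebra h) (S : vectType R[i]) (g : rep Cl S)
    (g_spin : spin_rep g) :
  (~~ odd (\dim {:V}) ->
    (exists (theta : {multiplicative Oh0 g -> Z2 R[i]})
            (i : {multiplicative Cdot (Spin g) -> Lpin g}),
       [/\ bijective theta, Cdot_map i &
           split_exact_seq i (theta \o kappa g)]) /\
    isomorphic (Lpin g) (Cdot (Pin g)))
  /\
  (odd (\dim {:V}) ->
    (exists (theta : {multiplicative Oh0 g -> sdprod (phi R[i])})
            (i : {multiplicative Cdot (Spin g) -> Lpin g})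
            (j : {multiplicative Cdot (Pin g) -> Lpin g}),
       [/\ bijective theta,
           Cdot_map i,
           exact_seq i (theta \o kappa g),
           Cdot_map j &
           exact_seq j (@sd_square R[i] \o (theta \o kappa g))]) /\
    (exists2 psi : autaction (Pin g) (mulgrp R[i] * mulgrp R[i])%type,
       swap_action psi & isomorphic (Pin_sdprod_quo psi) (Lpin g))).
Proof.
split=> [Veven|Vodd]; move: g_spin; rewrite /spin_rep.
  rewrite (negPf Veven) => -[_ irr _]; have S0 := irr.1.
  have [e eO] := orthonormal_frame_ex h_quad h_nondeg.
  have [T [TT TV TPin]] := even_twist_ex h_quad g eO Veven.
  apply: (even_dimension h_quad S0 eO m_gt0 TT TV) TPin => w wV.
  by apply: (schur irr) => x _; exact: comm_rep.
rewrite Vodd => -[P [s [[_ irr _ [e eO svol]] [j [j' jK j'K] gj]]]].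
have S0 := cartan_dim irr jK.
have [T [TT TV [E1 [E2 [[E12 E1E2 E2E1 TE1 TE2] [E1V commE sign]]]]]] :=
  cartan_structure eO Vodd irr svol jK j'K gj.
split.
  exact: (odd_kappa_sequences h_quad S0 eO TT TV E12 E1E2 E2E1 TE1 TE2 E1V commE sign).
exact: (odd_semidirect h_quad S0 eO TT TV E12 E1E2 E2E1 TE1 TE2 E1V commE).
Qed.
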